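(* Let $\mathfrak{g}$ be a complex Lie algebra with an invariant symmetric bilinear form $\langle\cdot,\cdot\rangle$, let $A$ be a commutative $\mathbb{C}$-algebra, $R=A[t,t^{-1}]$, and let $V(\widehat{\mathfrak{g}}_R)$ be the induced module, with vector $|0\rangle$ and operator $T$, defined in the context. Then the field assignments $$Y\big((J\otimes ut^{-1})|0\rangle,z\big)=\sum_{n\in\mathbb{Z}}(J\otimes ut^n)\,z^{-n-1},$$ $$Y\big(\overline{ut^{-1}dt}\,|0\rangle,z\big)=\sum_{n\in\mathbb{Z}}\overline{ut^{n-1}dt}\;z^{-n},$$ $$Y\big(\overline{t^{-1}\omega}\,|0\rangle,z\big)=\sum_{n\in\mathbb{Z}}\overline{t^n\omega}\;z^{-n-1}$$ for $J\in\mathfrak{g}$, $u\in A$, $\omega\in\Omega^1_A$, together with $T$ and the vacuum vector $|0\rangle$, equip $V(\widehat{\mathfrak{g}}_R)$ with the structure of a vertex algebra.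
   Context: $\Omega^1_R$ is the module of Kähler differentials of $R$ over $\mathbb{C}$ and $d:R\to\Omega^1_R$ the universal derivation; $\overline\omega$ denotes the class of $\omega\in\Omega^1_R$ in $\Omega^1_R/dR$. The Lie algebra $\widehat{\mathfrak{g}}_R=\mathfrak{g}\otimes R\oplus\Omega^1_R/dR$ has $\Omega^1_R/dR$ central and bracket $[J\otimes r,J'\otimes s]=[J,J']\otimes rs+\overline{\langle J,J'\rangle\,r\,ds}$. Its subalgebra $\widehat{\mathfrak{g}}^+_R$ is $\mathfrak{g}\otimes A[t]\oplus\Omega^1_{A[t]}/dA[t]$. Put $V(\widehat{\mathfrak{g}}_R)=\mathrm{Ind}^{\widehat{\mathfrak{g}}_R}_{\widehat{\mathfrak{g}}_R^+}\mathbb{C}=U(\widehat{\mathfrak{g}}_R)\otimes_{U(\widehat{\mathfrak{g}}_R^+)}\mathbb{C}$ with $\mathbb{C}$ the trivial representation, and $|0\rangle:=1\in\mathbb{C}$. The operator $T$ on $V(\widehat{\mathfrak{g}}_R)$ is determined by $T|0\rangle=0$, $[T,J\otimes ft^n]=-n\,J\otimes ft^{n-1}$, $[T,\overline{ft^ndt}]=-n\,\overline{ft^{n-1}dt}$, $[T,\overline{t^n\omega}]=-n\,\overline{t^{n-1}\omega}$ for $J\in\mathfrak{g}$, $f\in A$, $\omega\in\Omega^1_A$, $n\in\mathbb{Z}$. Elements of $\widehat{\mathfrak{g}}_R$ in the displayed fields act as endomorphisms of $V(\widehat{\mathfrak{g}}_R)$. A vertex algebra $(V,|0\rangle,T,Y)$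 is a complex vector space with a vector $|0\rangle$, a linear map $T:V\to V$ and a linear map $Y(-,z):V\to\mathrm{End}(V)[[z^{\pm1}]]$ such that each $Y(v,z)$ is a field ($Y(v,z)v'\in V((z))$); $Y(|0\rangle,z)=\mathrm{id}$ and $Y(v,z)|0\rangle\in v+zV[[z]]$; $T|0\rangle=0$ and $[T,Y(v,z)]=\partial_zY(v,z)$; and for all $v,v'$ there is $N$ with $(z-w)^N[Y(v,z),Y(v',w)]=0$. *)

(* Defs.v *)
From HB Require Import structures.
From mathcomp Require Import all_boot all_order all_algebra.
From mathcomp Require Import finmap boolp.

Set Implicit Arguments.
Unset Strict Implicit.
Unset Printing Implicit Defensive.

Import GRing.Theory Num.Theory.
Local Open Scope ring_scope.

(* A commutative K-algebra is represented throughout as a commutative ring S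
   with its structure morphism eta : {rmorphism K -> S}.  Together with the pz
   (possibly zero) ring structures this allows the zero algebra, which
   comAlgType excludes; it also keeps the K-module and S-module structures on
   the same carrier apart (see restr). *)

Definition freemod (K : pzRingType) (X : choiceType) := {fsfun X -> K with 0}.

Section FreeModule.
Variables (K : pzRingType) (X : choiceType).
Local Notation F := (freemod K X).

HB.instance Definition _ := Choice.on F.

Definition fbasis (x : X) : F := [fsfun y in [fset x]%fset => 1].

Let fzero : F := [fsfun].
Let fopp (f : F) : F := [fsfun x in finsupp f => - f x].
Let fadd (f g : F) : F := [fsfun x in (finsupp f `|` finsupp g)%fset => f x + g x].
Let fscale (c : K) (f : F) : F := [fsfun x in finsupp f => c * f x].

Let fzeroE x : fzero x = 0. Proof. by rewrite fsfunE. Qed.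
Let foppE f x : fopp f x = - f x.
Proof. by rewrite fsfunE; case: finsuppP => //; rewrite oppr0. Qed.
Let faddE f g x : fadd f g x = f x + g x.
Proof.
rewrite fsfunE in_fsetU; case: (finsuppP f x) => [fx|_] //=.
by case: (finsuppP g x) => // gx; rewrite addr0.
Qed.
Let fscaleE c f x : fscale c f x = c * f x.
Proof. by rewrite fsfunE; case: finsuppP => //; rewrite mulr0. Qed.

Fact freemod_addA : associative fadd.
Proof. by move=> f g h; apply/fsfunP => x; rewrite !faddE addrA. Qed.
Fact freemod_addC : commutative fadd.
Proof. by move=> f g; apply/fsfunP => x; rewrite !faddE addrC. Qed.
Fact freemod_add0 : left_id fzero fadd.
Proof. by move=> f; apply/fsfunP => x; rewrite faddE fzeroE add0r. Qed.
Fact freemod_addN : left_inverse fzero fopp fadd.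
Proof. by move=> f; apply/fsfunP => x; rewrite faddE foppE fzeroE addNr. Qed.
HB.instance Definition _ :=
  GRing.isZmodule.Build F freemod_addA freemod_addC freemod_add0 freemod_addN.

Lemma freemodD (f g : F) x : (f + g) x = f x + g x. Proof. exact: faddE. Qed.
Lemma freemodN (f : F) x : (- f) x = - f x. Proof. exact: foppE. Qed.
Lemma freemod0 x : (0 : F) x = 0. Proof. exact: fzeroE. Qed.

Fact freemod_scaleA a b f : fscale a (fscale b f) = fscale (a * b) f.
Proof. by apply/fsfunP => x; rewrite !fscaleE mulrA. Qed.
Fact freemod_scale1 : left_id 1 fscale.
Proof. by move=> f; apply/fsfunP => x; rewrite fscaleE mul1r. Qed.
Fact freemod_scaleDr : right_distributive fscale +%R.
Proof. by move=> c f g; apply/fsfunP => x; rewrite !(fscaleE, freemodD) mulrDr. Qed.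
Fact freemod_scaleDl f : {morph fscale^~ f : a b / a + b}.
Proof. by move=> a b; apply/fsfunP => x; rewrite !(fscaleE, freemodD) mulrDl. Qed.
HB.instance Definition _ := GRing.Zmodule_isLmodule.Build K F
  freemod_scaleA freemod_scale1 freemod_scaleDr freemod_scaleDl.

Lemma freemodZ c (f : F) x : (c *: f) x = c * f x. Proof. exact: fscaleE. Qed.

Lemma fbasisE x y : fbasis x y = (y == x)%:R.
Proof. by rewrite fsfunE in_fset1; case: eqP. Qed.

Lemma freemod_sum (I : Type) (r : seq I) (P : pred I) (f : I -> F) x :
  (\sum_(i <- r | P i) f i) x = \sum_(i <- r | P i) f i x.
Proof.
elim/big_rec2: _ => [|i y1 y2 _ <-]; first exact: freemod0.
exact: freemodD.
Qed.

Lemma freemodE (f : F) : f = \sum_(x <- finsupp f) f x *: fbasis x.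
Proof.
apply/fsfunP => y; rewrite freemod_sum.
under eq_bigr do rewrite freemodZ fbasisE.
case: (finsuppP f y) => [yNf|yf].
  rewrite big_seq big1 // => x xf; case: eqP => [yx|_]; last by rewrite mulr0.
  by rewrite yx xf in yNf.
rewrite (big_fsetD1 y) //= eqxx mulr1 big_seq big1 ?addr0 // => x.
by rewrite in_fsetD1 eq_sym => /andP[/negbTE-> _]; rewrite mulr0.
Qed.

Lemma freemod_ind (P : F -> Prop) :
  P 0 -> (forall c x f, P f -> P (c *: fbasis x + f)) -> forall f, P f.
Proof.
move=> P0 PD f; rewrite (freemodE f).
by elim/big_rec: _ => // x g _; apply: PD.
Qed.

(* The linear extension of f to the free module. *)
Definition flift (M : lmodType K) (f : X -> M) (v : F) : M :=
  \sum_(x <- finsupp v) v x *: f x.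

Lemma flift_wide (M : lmodType K) (f : X -> M) (v : F) (A : {fset X}) :
  (finsupp v `<=` A)%fset -> flift f v = \sum_(x <- A) v x *: f x.
Proof.
move=> vA; rewrite /flift; apply: big_fset_incl => // x xA xv.
by rewrite fsfun_dflt // scale0r.
Qed.

Fact flift_is_linear (M : lmodType K) (f : X -> M) : linear (flift f).
Proof.
move=> c u v; set w : F := c *: u + v.
pose A := (finsupp (u : F) `|` finsupp (v : F) `|` finsupp w)%fset.
have uA : (finsupp (u : F) `<=` A)%fset by rewrite /A -fsetUA fsubsetUl.
have vA : (finsupp (v : F) `<=` A)%fset by rewrite /A fsetUAC fsubsetUr.
have wA : (finsupp w `<=` A)%fset by rewrite /A fsubsetUr.
rewrite (flift_wide _ uA) (flift_wide _ vA) (flift_wide _ wA).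
rewrite scaler_sumr -big_split; apply: eq_bigr => x _.
by rewrite /w freemodD freemodZ scalerDl scalerA.
Qed.
HB.instance Definition _ (M : lmodType K) (f : X -> M) :=
  GRing.isLinear.Build K F M *:%R (flift f) (flift_is_linear f).

Lemma flift_fbasis (M : lmodType K) (f : X -> M) x : flift f (fbasis x) = f x.
Proof.
rewrite (@flift_wide _ _ _ [fset x]%fset); last first.
  apply/fsubsetP => y; rewrite mem_finsupp fbasisE in_fset1.
  by case: (y == x); rewrite // eqxx.
by rewrite big_seq_fset1 fbasisE eqxx scale1r.
Qed.

End FreeModule.

Lemma fliftDZ (K : comPzRingType) (X : choiceType) (M : lmodType K) (c : K)
    (f g : X -> M) (v : freemod K X) :
  flift (fun x => c *: f x + g x) v = c *: flift f v + flift g v.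
Proof.
rewrite /flift scaler_sumr -big_split; apply: eq_bigr => x _.
by rewrite scalerDr !scalerA mulrC.
Qed.

(* The monoid algebra K[M], with convolution product. *)
Definition monalg (K : comPzRingType) (M : choiceType) (e : M)
  (op : Monoid.law e) := freemod K M.

Section MonoidAlgebra.
Variables (K : comPzRingType) (M : choiceType) (e : M) (op : Monoid.law e).
Local Notation A := (monalg K op).
Local Notation δ x := (@fbasis K M x : A).

HB.instance Definition _ := GRing.Lmodule.on A.

Let one : A := δ e.
Let mul (f g : A) : A := flift (fun x => flift (fun y => δ (op x y)) g) f.

Let mulDZl c (f g h : A) : mul (c *: f + g) h = c *: mul f h + mul g h.
Proof. exact: linearP. Qed.
Let mulDZr c (f g h : A) : mul f (c *: g + h) = c *: mul f g + mul f h.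
Proof.
rewrite /mul -fliftDZ; congr flift; apply: funext => x; exact: linearP.
Qed.
Let mul_0l f : mul 0 f = 0. Proof. exact: linear0. Qed.
Let mul_0r f : mul f 0 = 0.
Proof. by have := mulDZr (-1) f 0 0; rewrite scaler0 addr0 scaleN1r addNr. Qed.
Let mulδ x y : mul (δ x) (δ y) = δ (op x y).
Proof. by rewrite /mul !flift_fbasis. Qed.

Fact monalg_mulA : associative mul.
Proof.
move=> f g h; elim/freemod_ind: f => [|c x f IH]; first by rewrite !mul_0l.
rewrite !mulDZl {}IH; congr (_ *: _ + _).
elim/freemod_ind: g => [|d y g IH]; first by rewrite !(mul_0l, mul_0r).
rewrite !(mulDZl, mulDZr) {}IH; congr (_ *: _ + _).
elim/freemod_ind: h => [|b z h IH]; first by rewrite !mul_0r.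
by rewrite !mulDZr {}IH; congr (_ *: _ + _); rewrite !mulδ Monoid.mulmA.
Qed.
Fact monalg_mul1l : left_id one mul.
Proof.
move=> f; elim/freemod_ind: f => [|c x f IH]; first by rewrite mul_0r.
by rewrite mulDZr IH mulδ Monoid.mul1m.
Qed.
Fact monalg_mul1r : right_id one mul.
Proof.
move=> f; elim/freemod_ind: f => [|c x f IH]; first by rewrite mul_0l.
by rewrite mulDZl IH mulδ Monoid.mulm1.
Qed.
Fact monalg_mulDl : left_distributive mul +%R.
Proof. by move=> f g h; have := mulDZl 1 f g h; rewrite !scale1r. Qed.
Fact monalg_mulDr : right_distributive mul +%R.
Proof. by move=> f g h; have := mulDZr 1 f g h; rewrite !scale1r. Qed.
HB.instance Definition _ := GRing.Zmodule_isPzRing.Build A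
  monalg_mulA monalg_mul1l monalg_mul1r monalg_mulDl monalg_mulDr.

Fact monalg_scaleAl (c : K) (f g : A) : c *: (f * g) = (c *: f) * g.
Proof. by have := mulDZl c f 0 g; rewrite mul_0l !addr0 => <-. Qed.
Fact monalg_scaleAr (c : K) (f g : A) : c *: (f * g) = f * (c *: g).
Proof. by have := mulDZr c f g 0; rewrite mul_0r !addr0 => <-. Qed.

Lemma monalg_basisM x y : δ x * δ y = δ (op x y). Proof. exact: mulδ. Qed.
Lemma monalg_basis1 : δ e = 1. Proof. by []. Qed.

End MonoidAlgebra.

Definition comonalg (A : comPzRingType) (M : choiceType)
  (e : M) (op : Monoid.com_law e) := monalg A op.

Section ComMonoidAlgebra.
Variables (A : comPzRingType) (M : choiceType) (e : M) (op : Monoid.com_law e).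
Local Notation S := (comonalg A op).

HB.instance Definition _ := GRing.PzRing.on S.
HB.instance Definition _ := GRing.Lmodule.on S.

(* The monomial a t^m. *)
Definition mono (a : A) (m : M) : S := a *: (@fbasis A M m : S).

Lemma monoM a b m n : mono a m * mono b n = mono (a * b) (op m n).
Proof.
rewrite /mono -[LHS]monalg_scaleAl -monalg_scaleAr scalerA.
by congr (_ *: _); apply: monalg_basisM.
Qed.

Lemma mono1 : mono 1 e = 1. Proof. by rewrite /mono scale1r. Qed.

Lemma monoD a b m : mono (a + b) m = mono a m + mono b m.
Proof. exact: scalerDl. Qed.

Lemma comonalg_ind (P : S -> Prop) :
  P 0 -> (forall a m f, P f -> P (mono a m + f)) -> forall f, P f.
Proof. by move=> P0 PD f; apply: (@freemod_ind A M P P0 PD f). Qed.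

Fact comonalg_mulC (f g : S) : f * g = g * f.
Proof.
elim/comonalg_ind: f => [|a m f IH]; first by rewrite mul0r mulr0.
rewrite mulrDl mulrDr {}IH; congr (_ + _).
elim/comonalg_ind: g => [|b n g IH]; first by rewrite mul0r mulr0.
by rewrite mulrDl mulrDr {}IH !monoM [a * b]mulrC [op m n]Monoid.mulmC.
Qed.
HB.instance Definition _ := GRing.PzRing_hasCommutativeMul.Build S comonalg_mulC.

Definition mconst (a : A) : S := mono a e.

Fact mconst_zmod : zmod_morphism mconst.
Proof. by move=> a b; apply: scalerBl. Qed.
Fact mconst_monoid : monoid_morphism mconst.
Proof. by split=> [|a b]; rewrite /mconst ?mono1 // monoM Monoid.mulm1. Qed.
HB.instance Definition _ := GRing.isZmodMorphism.Build A S mconst mconst_zmod.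
HB.instance Definition _ := GRing.isMonoidMorphism.Build A S mconst mconst_monoid.

End ComMonoidAlgebra.

Section Laurent.
Variable (A : comPzRingType).

(* A[t] and A[t, t^-1] are the monoid algebras A[nat] and A[int]; {poly A}
   would require A to be nonzero. *)
Definition polyt := comonalg A addn.
Definition laurent := comonalg A (+%R : Monoid.com_law (0 : int)).

HB.instance Definition _ := GRing.ComPzRing.on polyt.
HB.instance Definition _ := GRing.ComPzRing.on laurent.

Definition pmono (a : A) (n : nat) : polyt := mono addn a n.
Definition lmono (a : A) (n : int) : laurent := mono +%R a n.
Definition pconst (a : A) : polyt := pmono a 0.
Definition lconst (a : A) : laurent := lmono a 0.

HB.instance Definition _ := GRing.RMorphism.copy pconst (@mconst A _ _ addn).
HB.instance Definition _ :=
  GRing.RMorphism.copy lconst (@mconst A _ _ (+%R : Monoid.com_law (0 : int))).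

Definition polyt_incl (f : polyt) : laurent :=
  flift (fun n : nat => lmono 1 n%:Z) f.

Fact polyt_incl_zmod : zmod_morphism polyt_incl.
Proof. exact: raddfB. Qed.

Lemma polyt_inclE a n : polyt_incl (pmono a n) = lmono a n%:Z.
Proof.
by rewrite /polyt_incl [LHS]linearZ /= flift_fbasis /lmono /mono scale1r.
Qed.

Fact polyt_incl_monoid : monoid_morphism polyt_incl.
Proof.
split=> [|f g]; first by rewrite -[1](mono1 A addn) [LHS]polyt_inclE; apply: mono1.
have incl0 : polyt_incl 0 = 0 by exact: raddf0.
have inclD u v : polyt_incl (u + v) = polyt_incl u + polyt_incl v by exact: raddfD.
elim/comonalg_ind: f => [|a m f IH]; first by rewrite mul0r incl0 mul0r.
rewrite mulrDl !inclD mulrDl {}IH; congr (_ + _).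
elim/comonalg_ind: g => [|b n g IH]; first by rewrite mulr0 incl0 mulr0.
rewrite mulrDr !inclD mulrDr {}IH; congr (_ + _).
by rewrite [X in polyt_incl X]monoM !polyt_inclE [RHS]monoM.
Qed.

HB.instance Definition _ :=
  GRing.isZmodMorphism.Build polyt laurent polyt_incl polyt_incl_zmod.
HB.instance Definition _ :=
  GRing.isMonoidMorphism.Build polyt laurent polyt_incl polyt_incl_monoid.
End Laurent.

Inductive span (K : pzRingType) (V : lmodType K) (S : V -> Prop) : V -> Prop :=
| span0 : span S 0
| spanDZ c s v : S s -> span S v -> span S (c *: s + v).

Section Span.
Variables (K : pzRingType) (V : lmodType K) (S : V -> Prop).

Lemma span_gen s : S s -> span S s.
Proof. by move=> Ss; rewrite -[s]addr0 -[s]scale1r; apply: spanDZ (span0 _). Qed.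

Lemma spanD u v : span S u -> span S v -> span S (u + v).
Proof.
elim=> [|c s w Ss _ IH] Sv; first by rewrite add0r.
by rewrite -addrA; apply: spanDZ (IH Sv).
Qed.

Lemma spanZ a u : span S u -> span S (a *: u).
Proof.
elim=> [|c s w Ss _ IH]; first by rewrite scaler0; apply: span0.
by rewrite scalerDr scalerA; apply: spanDZ IH.
Qed.

Lemma spanN u : span S u -> span S (- u).
Proof. by rewrite -scaleN1r; apply: spanZ. Qed.

Lemma span_linear (W : lmodType K) (f : {linear V -> W}) :
  (forall s, S s -> f s = 0) -> forall v, span S v -> f v = 0.
Proof.
move=> fS v; elim=> [|c s w Ss _ IH]; first exact: linear0.
by rewrite linearP fS // IH scaler0 addr0.
Qed.
End Span.

(* mquot S is the quotient of V by the submodule generated by S. *)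
Definition mquot_equiv (K : pzRingType) (V : lmodType K) (S : V -> Prop) : rel V :=
  fun u v => `[< span S (u - v) >].

Section ModuleQuotient.
Variables (K : pzRingType) (V : lmodType K) (S : V -> Prop).
Local Open Scope quotient_scope.

Fact mquot_equiv_refl : reflexive (mquot_equiv S).
Proof. by move=> u; apply/asboolP; rewrite subrr; apply: span0. Qed.
Fact mquot_equiv_sym : symmetric (mquot_equiv S).
Proof.
by move=> u v; apply/asboolP/asboolP => /spanN; rewrite opprB.
Qed.
Fact mquot_equiv_trans : transitive (mquot_equiv S).
Proof.
move=> v u w /asboolP uv /asboolP vw; apply/asboolP.
by rewrite -(subrKA v); apply: spanD.
Qed.
Canonical mquot_equivRel :=
  EquivRel (mquot_equiv S) mquot_equiv_refl mquot_equiv_sym mquot_equiv_trans.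

Record mquot := MQuot { mquot_val : {eq_quot mquot_equivRel} }.
HB.instance Definition _ := [isNew for mquot_val].
HB.instance Definition _ := [Choice of mquot by <:].

Definition mcls (v : V) : mquot := MQuot (\pi v).
Definition mrepr (x : mquot) : V := repr (mquot_val x).

Lemma mclsP u v : mcls u = mcls v <-> span S (u - v).
Proof.
split=> [[/eqmodP/asboolP]|uv] //; congr MQuot.
by apply/eqmodP/asboolP.
Qed.

Lemma mreprK (x : mquot) : mcls (mrepr x) = x.
Proof. by case: x => x; rewrite /mcls /mrepr reprK. Qed.

Lemma mquot_ind (P : mquot -> Prop) : (forall v, P (mcls v)) -> forall x, P x.
Proof. by move=> Pm x; rewrite -(mreprK x). Qed.

Let zero := mcls 0.
Let opp (x : mquot) := mcls (- mrepr x).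
Let add (x y : mquot) := mcls (mrepr x + mrepr y).
Let scale (c : K) (x : mquot) := mcls (c *: mrepr x).

Let reprP v : span S (mrepr (mcls v) - v).
Proof. by apply/mclsP; rewrite mreprK. Qed.

Let oppE v : opp (mcls v) = mcls (- v).
Proof. by apply/mclsP; rewrite -opprD; apply: spanN. Qed.
Let addE u v : add (mcls u) (mcls v) = mcls (u + v).
Proof. by apply/mclsP; rewrite opprD addrACA; apply: spanD. Qed.
Let scaleE c v : scale c (mcls v) = mcls (c *: v).
Proof. by apply/mclsP; rewrite -scalerBr; apply: spanZ. Qed.

Fact mquot_addA : associative add.
Proof.
by elim/mquot_ind=> x; elim/mquot_ind=> y; elim/mquot_ind=> z; rewrite !addE addrA.
Qed.
Fact mquot_addC : commutative add.
Proof. by elim/mquot_ind=> x; elim/mquot_ind=> y; rewrite !addE addrC. Qed.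
Fact mquot_add0 : left_id zero add.
Proof. by elim/mquot_ind=> x; rewrite addE add0r. Qed.
Fact mquot_addN : left_inverse zero opp add.
Proof. by elim/mquot_ind=> x; rewrite oppE addE addNr. Qed.
HB.instance Definition _ :=
  GRing.isZmodule.Build mquot mquot_addA mquot_addC mquot_add0 mquot_addN.

Lemma mclsD u v : mcls (u + v) = mcls u + mcls v. Proof. by rewrite [RHS]addE. Qed.

Fact mquot_scaleA a b x : scale a (scale b x) = scale (a * b) x.
Proof. by elim/mquot_ind: x => x; rewrite !scaleE scalerA. Qed.
Fact mquot_scale1 : left_id 1 scale.
Proof. by elim/mquot_ind=> x; rewrite scaleE scale1r. Qed.
Fact mquot_scaleDr : right_distributive scale +%R.
Proof.
by move=> c; elim/mquot_ind=> x; elim/mquot_ind=> y; rewrite -mclsD !scaleE scalerDr mclsD.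
Qed.
Fact mquot_scaleDl x : {morph scale^~ x : a b / a + b}.
Proof. by elim/mquot_ind: x => x a b; rewrite !scaleE scalerDl mclsD. Qed.
HB.instance Definition _ := GRing.Zmodule_isLmodule.Build K mquot
  mquot_scaleA mquot_scale1 mquot_scaleDr mquot_scaleDl.

Fact mcls_is_linear : linear mcls.
Proof. by move=> c u v; rewrite mclsD -scaleE. Qed.
HB.instance Definition _ := GRing.isLinear.Build K V mquot *:%R mcls mcls_is_linear.

Lemma mcls_gen s : S s -> mcls s = 0.
Proof. by move=> Ss; apply/mclsP; rewrite subr0; apply: span_gen. Qed.

(* The map induced on the quotient by f, when f respects it (see mlift_cls). *)
Definition mlift (W : Type) (f : V -> W) (x : mquot) : W := f (mrepr x).

Lemma mlift_cls (W : lmodType K) (f : {linear V -> W}) v :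
  (forall s, S s -> f s = 0) -> mlift f (mcls v) = f v.
Proof.
move=> fS; apply/eqP; rewrite -subr_eq0 -linearB; apply/eqP.
exact: span_linear fS _ (reprP v).
Qed.

Lemma mlift_linear (W : lmodType K) (f : {linear V -> W}) :
  (forall s, S s -> f s = 0) -> linear (mlift f).
Proof.
move=> fS c; elim/mquot_ind=> u; elim/mquot_ind=> v.
by rewrite -linearP !mlift_cls // linearP.
Qed.
End ModuleQuotient.

Section Tensor.
Variables (K : comPzRingType) (M N : lmodType K).
Local Notation "⟨ m , n ⟩" := (@fbasis K (M * N)%type (m, n)).

Variant bilin_rel : freemod K (M * N)%type -> Prop :=
| bilin_l c m m' n : bilin_rel (⟨c *: m + m', n⟩ - (c *: ⟨m, n⟩ + ⟨m', n⟩))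
| bilin_r c m n n' : bilin_rel (⟨m, c *: n + n'⟩ - (c *: ⟨m, n⟩ + ⟨m, n'⟩)).

Definition tensor := mquot bilin_rel.
HB.instance Definition _ := GRing.Lmodule.on tensor.

Definition tens (m : M) (n : N) : tensor := mcls bilin_rel ⟨m, n⟩.

Lemma tens_linl c m m' n : tens (c *: m + m') n = c *: tens m n + tens m' n.
Proof.
apply/eqP; rewrite -subr_eq0 /tens -linearP -linearB; apply/eqP/mcls_gen.
exact: bilin_l.
Qed.

Lemma tens_linr c m n n' : tens m (c *: n + n') = c *: tens m n + tens m n'.
Proof.
apply/eqP; rewrite -subr_eq0 /tens -linearP -linearB; apply/eqP/mcls_gen.
exact: bilin_r.
Qed.

Lemma tens0l n : tens 0 n = 0.
Proof. by have := tens_linl (-1) 0 0 n; rewrite scaler0 addr0 scaleN1r addNr. Qed.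

Lemma tensZl c m n : tens (c *: m) n = c *: tens m n.
Proof. by rewrite -[c *: m]addr0 tens_linl tens0l addr0. Qed.

Lemma tensor_ind (P : tensor -> Prop) :
  P 0 -> (forall m n x, P x -> P (tens m n + x)) -> forall x, P x.
Proof.
move=> P0 PD; elim/mquot_ind; elim/freemod_ind=> [|c [m n] x IH].
  by rewrite linear0.
have -> : mcls bilin_rel (c *: ⟨m, n⟩ + x) = tens (c *: m) n + mcls bilin_rel x.
  by rewrite tensZl [LHS]linearP.
exact: PD.
Qed.

Definition bilin (W : lmodType K) (f : M -> N -> W) :=
  (forall n, linear (f^~ n)) /\ (forall m, linear (f m)).

(* The linear map on the tensor product induced by a bilinear f (see tliftE). *)
Definition tlift (W : lmodType K) (f : M -> N -> W) : tensor -> W :=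
  mlift (flift (fun p => f p.1 p.2)).

Lemma tliftDZ (W : lmodType K) c (f g : M -> N -> W) x :
  tlift (fun m n => c *: f m n + g m n) x = c *: tlift f x + tlift g x.
Proof. exact: fliftDZ. Qed.

Section Lift.
Variables (W : lmodType K) (f : M -> N -> W).
Hypothesis f_bilin : bilin f.

Fact tlift_rel s : bilin_rel s -> flift (fun p => f p.1 p.2) s = 0.
Proof.
by case: f_bilin => fl fr; case=> c m n n';
   rewrite linearB linearP /= !flift_fbasis /= ?fl ?fr subrr.
Qed.

Lemma tliftE m n : tlift f (tens m n) = f m n.
Proof. by rewrite [LHS](mlift_cls _ tlift_rel) /= flift_fbasis. Qed.

Lemma tlift_linear : linear (tlift f).
Proof. exact: mlift_linear tlift_rel. Qed.
End Lift.
End Tensor.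

HB.mixin Record isLie (K : pzRingType) L of GRing.Lmodule K L := {
  lie : L -> L -> L;
  lie_linearl : forall y, linear (lie^~ y);
  lie_linearr : forall x, linear (lie x);
  liexx : forall x, lie x x = 0;
  lie_jacobi : forall x y z, lie x (lie y z) + lie y (lie z x) + lie z (lie x y) = 0
}.

#[short(type="lieAlgType")]
HB.structure Definition LieAlgebra (K : pzRingType) :=
  {L of GRing.Lmodule K L & isLie K L}.

Record invariant_form (K : numFieldType) (g : lieAlgType K) := InvariantForm {
  form :> {symmetric g};
  form_inv : forall a b c, form (lie a b) c = form a (lie b c)
}.

(* Restriction of scalars along eta. *)
Definition restr (K S : pzRingType) (eta : {rmorphism K -> S}) (M : lmodType S) : Type := M.

Section RestrictScalars.
Variables (K S : pzRingType) (eta : {rmorphism K -> S}) (M : lmodType S).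
Local Notation N := (restr eta M).
HB.instance Definition _ := GRing.Zmodule.on N.
Let scale (c : K) (m : N) : N := eta c *: (m : M).
Fact restr_scaleA a b m : scale a (scale b m) = scale (a * b) m.
Proof. by rewrite /scale scalerA rmorphM. Qed.
Fact restr_scale1 : left_id 1 scale.
Proof. by move=> m; rewrite /scale rmorph1 scale1r. Qed.
Fact restr_scaleDr : right_distributive scale +%R.
Proof. by move=> c m n; apply: scalerDr. Qed.
Fact restr_scaleDl m : {morph scale^~ m : a b / a + b}.
Proof. by move=> a b; rewrite /scale rmorphD scalerDl. Qed.
HB.instance Definition _ := GRing.Zmodule_isLmodule.Build K N
  restr_scaleA restr_scale1 restr_scaleDr restr_scaleDl.
Lemma restr_scaleE c (m : N) : c *: m = eta c *: (m : M). Proof. by []. Qed.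
End RestrictScalars.

Section Kaehler.
Variables (K S : comPzRingType) (eta : {rmorphism K -> S}).
Local Notation δ f := (@fbasis S S f).

Variant kaehler_rel : freemod S S -> Prop :=
| kaehler_const c : kaehler_rel (δ (eta c))
| kaehler_add f g : kaehler_rel (δ (f + g) - (δ f + δ g))
| kaehler_leibniz f g : kaehler_rel (δ (f * g) - (f *: δ g + g *: δ f)).

Definition kaehler := mquot kaehler_rel.
HB.instance Definition _ := GRing.Lmodule.on kaehler.

Definition kd (f : S) : kaehler := mcls kaehler_rel (δ f).

Lemma kd_const c : kd (eta c) = 0.
Proof. by apply: mcls_gen; apply: kaehler_const. Qed.

Lemma kdD f g : kd (f + g) = kd f + kd g.
Proof.
rewrite -[RHS](linearD (mcls kaehler_rel)).
by apply/mclsP/span_gen/kaehler_add.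
Qed.

Lemma kdM f g : kd (f * g) = f *: kd g + g *: kd f.
Proof.
transitivity (mcls kaehler_rel (f *: δ g + g *: δ f)); last first.
  by rewrite linearD !linearZ.
by apply/mclsP/span_gen/kaehler_leibniz.
Qed.

Lemma kdZ c f : kd (eta c * f) = eta c *: kd f.
Proof. by rewrite kdM kd_const scaler0 addr0. Qed.

Lemma kd_cyclic f g h :
  f *: kd (g * h) + g *: kd (h * f) + h *: kd (f * g) =
  kd (f * g * h) + kd (f * g * h).
Proof.
rewrite !kdM !scalerDr !scalerA [h * f]mulrC [h * g]mulrC [g * f]mulrC.
rewrite (AC (2*2*2) ((1*(2*3))*(4*(5*6)))) /=.
by congr (_ + _).
Qed.

Lemma kaehler_ind (P : kaehler -> Prop) :
  P 0 -> (forall f g w, P w -> P (f *: kd g + w)) -> forall w, P w.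
Proof.
move=> P0 PD; elim/mquot_ind; elim/freemod_ind=> [|f g w IH].
  by rewrite linear0.
have -> : mcls kaehler_rel (f *: δ g + w) = f *: kd g + mcls kaehler_rel w.
  by rewrite [LHS]linearP.
exact: PD.
Qed.

Definition kaehlerK := restr eta kaehler.
HB.instance Definition _ := GRing.Lmodule.on kaehlerK.

Definition kaehler_exact (w : kaehlerK) : Prop := exists f, w = kd f.

(* The quotient of the Kaehler differentials by the exact ones. *)
Definition kaehlerH := mquot kaehler_exact.
HB.instance Definition _ := GRing.Lmodule.on kaehlerH.

Definition kcls (w : kaehler) : kaehlerH := mcls kaehler_exact w.

Lemma kclsD u v : kcls (u + v) = kcls u + kcls v.
Proof. exact: linearD. Qed.

Lemma kclsZ c w : kcls (eta c *: w) = c *: kcls w.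
Proof. exact: (linearZ_LR (mcls kaehler_exact)). Qed.

Lemma kcls_exact f : kcls (kd f) = 0.
Proof. by apply: mcls_gen; exists f. Qed.
Lemma kcls_linl c f f' w :
  kcls ((eta c * f + f') *: w) = c *: kcls (f *: w) + kcls (f' *: w).
Proof. by rewrite scalerDl kclsD -scalerA kclsZ. Qed.

Lemma kcls_linr c f g g' :
  kcls (f *: kd (eta c * g + g')) = c *: kcls (f *: kd g) + kcls (f *: kd g').
Proof.
by rewrite kdD kdZ scalerDr kclsD !scalerA [f * _]mulrC -scalerA kclsZ.
Qed.
End Kaehler.

Section KaehlerMap.
Variables (K S S' : comPzRingType).
Variables (eta : {rmorphism K -> S}) (eta' : {rmorphism K -> S'}).
Variable phi : {rmorphism S -> S'}.

(* f dg |-> phi(f) d(phi g). *)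
Definition kaehler_map : kaehler eta -> kaehler eta' :=
  mlift (flift (fun f => kd eta' (phi f) : restr phi (kaehler eta'))).

Definition kaehlerH_map : kaehlerH eta -> kaehlerH eta' :=
  @mlift K (kaehlerK eta) (@kaehler_exact K S eta) _
    (fun w => kcls (kaehler_map w)).

Hypothesis phi_eta : forall c, phi (eta c) = eta' c.

Fact kaehler_map_rel s : kaehler_rel eta s ->
  flift (fun f => kd eta' (phi f) : restr phi (kaehler eta')) s = 0.
Proof.
case=> [c|f g|f g].
- by rewrite flift_fbasis -(kd_const eta' c) -phi_eta.
- by rewrite linearB linearD /= !flift_fbasis rmorphD kdD subrr.
- by rewrite linearB linearD !linearZ /= !flift_fbasis rmorphM kdM subrr.
Qed.

Lemma kaehler_mapD u v : kaehler_map (u + v) = kaehler_map u + kaehler_map v.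
Proof.
have := mlift_linear kaehler_map_rel 1 u v.
by rewrite !scale1r.
Qed.

Lemma kaehler_map_d f g : kaehler_map (f *: kd eta g) = phi f *: kd eta' (phi g).
Proof.
by rewrite /kaehler_map /kd -linearZ [LHS](mlift_cls _ kaehler_map_rel) linearZ /= flift_fbasis.
Qed.

Lemma kaehler_mapZ f w : kaehler_map (f *: w) = phi f *: kaehler_map w.
Proof.
have map0 : kaehler_map 0 = 0.
  by apply: (addIr (kaehler_map 0)); rewrite -kaehler_mapD !add0r.
rewrite -[f *: w]addr0; apply: etrans (mlift_linear kaehler_map_rel f w 0) _.
by rewrite [X in _ + X]map0 addr0.
Qed.

Lemma kaehlerH_map_cls w : kaehlerH_map (kcls w) = kcls (kaehler_map w).
Proof.
have lin : linear (fun w : kaehlerK eta => kcls (kaehler_map w)).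
  move=> c u v; rewrite -kclsZ -kclsD; congr kcls.
  by rewrite kaehler_mapD; congr (_ + _); rewrite kaehler_mapZ -phi_eta.
pose f : {linear kaehlerK eta -> kaehlerH eta'} :=
  HB.pack (fun w : kaehlerK eta => kcls (kaehler_map w))
    (GRing.isLinear.Build _ _ _ _ _ lin).
rewrite [LHS](mlift_cls (f := f)) // => _ [h ->] /=.
by rewrite -[kd eta h]scale1r kaehler_map_d rmorph1 scale1r kcls_exact.
Qed.
End KaehlerMap.

Section TensorLift2.
Variables (K : comPzRingType) (M N M' N' W : lmodType K).
Variable f : M -> N -> M' -> N' -> W.

Definition tlift2 (x : tensor M N) (y : tensor M' N') : W :=
  tlift (fun m n => tlift (f m n) y) x.

Hypothesis f_lin1 : forall n m' n', linear (fun m => f m n m' n').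
Hypothesis f_lin2 : forall m m' n', linear (fun n => f m n m' n').
Hypothesis f_bilin : forall m n, bilin (f m n).

Let inner_bilin y : bilin (fun m n => tlift (f m n) y).
Proof.
split=> [n c u v|m c u v]; rewrite -tliftDZ; congr tlift;
  by apply: funext => m'; apply: funext => n'; rewrite (f_lin1, f_lin2).
Qed.

Lemma tlift2E m n m' n' : tlift2 (tens m n) (tens m' n') = f m n m' n'.
Proof. by rewrite /tlift2 !tliftE. Qed.

Lemma tlift2_linearl y : linear (tlift2^~ y).
Proof. exact: tlift_linear (inner_bilin y). Qed.

Lemma tlift2_linearr x : linear (tlift2 x).
Proof.
move=> c u v; rewrite /tlift2 -tliftDZ; congr tlift.
by apply: funext => m; apply: funext => n; rewrite tlift_linear.
Qed.
End TensorLift2.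

Section TensorIdentities.
Variables (K : comPzRingType) (M N : lmodType K) (W : zmodType).
Local Notation T := (tensor M N).

Let morph0 (U U' : zmodType) (h : U -> U') :
  {morph h : a b / a + b} -> h 0 = 0.
Proof. by move=> hD; apply: (addIr (h 0)); rewrite -hD !add0r. Qed.

Variables (b : T -> T -> T) (h : T -> T -> W).
Hypothesis bDl : forall y, {morph (fun x => b x y) : a b / a + b}.
Hypothesis bDr : forall x, {morph (fun y => b x y) : a b / a + b}.
Hypothesis hDl : forall y, {morph (fun x => h x y) : a b / a + b}.
Hypothesis hDr : forall x, {morph (fun y => h x y) : a b / a + b}.

Lemma tensor_skew :
  (forall m n m' n', h (tens m n) (tens m' n') + h (tens m' n') (tens m n) = 0) ->
  forall x y, h x y + h y x = 0.
Proof.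
move=> h0 x y; elim/tensor_ind: x => [|m n x IHx].
  by rewrite (morph0 (hDl y)) (morph0 (hDr y)) addr0.
rewrite hDl hDr addrACA {}IHx addr0; elim/tensor_ind: y => [|m' n' y IHy].
  by rewrite (morph0 (hDl _)) (morph0 (hDr _)) addr0.
by rewrite hDl hDr addrACA {}IHy addr0.
Qed.

Lemma tensor_cyclic (c := fun x y z => h x (b y z) + h y (b z x) + h z (b x y)) :
  (forall m n m' n' m'' n'', c (tens m n) (tens m' n') (tens m'' n'') = 0) ->
  forall x y z, c x y z = 0.
Proof.
move=> c0.
have cC x y z : c x y z = c y z x by rewrite /c -addrA addrC.
have cD y z : {morph (fun x => c x y z) : a b / a + b}.
  move=> u v; rewrite /c !(bDl, bDr, hDl, hDr) [RHS]addrACA; congr (_ + _).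
  exact: addrACA.
move=> x y z; elim/tensor_ind: x => [|m n x IHx]; first exact: (morph0 (cD y z)).
rewrite cD {}IHx addr0 cC; elim/tensor_ind: y => [|m' n' y IHy].
  exact: (morph0 (cD _ _)).
rewrite cD {}IHy addr0 cC; elim/tensor_ind: z => [|m'' n'' z IHz].
  exact: (morph0 (cD _ _)).
by rewrite cD {}IHz addr0 cC.
Qed.
End TensorIdentities.

(* The form only enters through the bracket; it is an argument of the type so
   that the Lie algebra structure can be inferred. *)
Definition ghat (K : numFieldType) (g : lieAlgType K) (B : invariant_form g)
    (S : comPzRingType) (eta : {rmorphism K -> S}) : Type :=
  (tensor g (restr eta S^o) * kaehlerH eta)%type.

Section Ghat.
Variables (K : numFieldType) (g : lieAlgType K) (B : invariant_form g).
Variables (S : comPzRingType) (eta : {rmorphism K -> S}).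
Local Notation SK := (restr eta S^o).
Local Notation cl := (@kcls K S eta).
Local Notation H := (kaehlerH eta).
Local Notation "J ⊗ r" := (@tens K g SK J r) (at level 40).

Definition cur_lie : tensor g SK -> tensor g SK -> tensor g SK :=
  tlift2 (fun J (r : SK) J' (s : SK) => lie J J' ⊗ (r * s : S)).

Definition cocycle : tensor g SK -> tensor g SK -> H :=
  tlift2 (fun J (r : SK) J' (s : SK) => B J J' *: cl (r *: kd eta s)).

Let lie_l1 (n : SK) m' (n' : SK) :
  linear (fun m : g => lie m m' ⊗ (n * n' : S)).
Proof. by move=> c u v; rewrite lie_linearl tens_linl. Qed.
Let lie_l2 (m m' : g) (n' : SK) :
  linear (fun n : SK => lie m m' ⊗ (n * n' : S)).
Proof.
by move=> c u v; rewrite -tens_linr; congr tens; rewrite mulrDl -mulrA.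
Qed.
Let lie_l3 (m : g) (n : SK) :
  bilin (fun m' (n' : SK) => lie m m' ⊗ (n * n' : S)).
Proof.
split=> [n' c u v|m' c u v]; first by rewrite lie_linearr tens_linl.
by rewrite -tens_linr; congr tens; rewrite mulrDr mulrCA.
Qed.
Let coc_l1 (n : SK) m' (n' : SK) :
  linear (fun m : g => B m m' *: cl (n *: kd eta n')).
Proof. by move=> c u v; rewrite linearPl scalerDl scalerA. Qed.
Let coc_l2 (m m' : g) (n' : SK) :
  linear (fun n : SK => B m m' *: cl ((n : S) *: kd eta n')).
Proof.
move=> c u v; rewrite [X in _ *: X](@kcls_linl K S eta c u v _) scalerDr !scalerA.
by rewrite mulrC.
Qed.
Let coc_l3 (m : g) (n : SK) :
  bilin (fun m' (n' : SK) => B m m' *: cl ((n : S) *: kd eta n')).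
Proof.
split=> [n' c u v|m' c u v]; first by rewrite linearPr scalerDl scalerA.
by rewrite [X in _ *: X](@kcls_linr K S eta c n u v) scalerDr !scalerA mulrC.
Qed.

Lemma cur_lieE J r J' s : cur_lie (J ⊗ r) (J' ⊗ s) = lie J J' ⊗ (r * s : S).
Proof. exact: tlift2E. Qed.
Lemma cocycleE J r J' s :
  cocycle (J ⊗ r) (J' ⊗ s) = B J J' *: cl ((r : S) *: kd eta s).
Proof. exact: tlift2E. Qed.
Lemma cur_lie_linearl y : linear (cur_lie^~ y). Proof. exact: tlift2_linearl. Qed.
Lemma cur_lie_linearr x : linear (cur_lie x). Proof. exact: tlift2_linearr. Qed.
Lemma cocycle_linearl y : linear (cocycle^~ y). Proof. exact: tlift2_linearl. Qed.
Lemma cocycle_linearr x : linear (cocycle x). Proof. exact: tlift2_linearr. Qed.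

Let linD (U W : lmodType K) (f : U -> W) : linear f -> {morph f : a b / a + b}.
Proof. by move=> fl a b; have := fl 1 a b; rewrite !scale1r. Qed.
Let lin0 (U W : lmodType K) (f : U -> W) : linear f -> f 0 = 0.
Proof. by move=> /linD fD; apply: (addIr (f 0)); rewrite -fD !add0r. Qed.

Let cDl y := linD (cur_lie_linearl y).
Let cDr x := linD (cur_lie_linearr x).
Let oDl y := linD (cocycle_linearl y).
Let oDr x := linD (cocycle_linearr x).

Let double0 (W : lmodType K) (w : W) : w + w = 0 -> w = 0.
Proof.
move=> w2; have {}w2 : 2%:R *: w = 0 by rewrite scaler_nat.
by rewrite -[w]scale1r -(@mulVf K 2%:R) ?pnatr_eq0 // -scalerA w2 scaler0.
Qed.

Let lieN (x y : g) : lie x y + lie y x = 0.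
Proof.
have := liexx (x + y); rewrite (linD (lie_linearl _)) !(linD (lie_linearr _)).
by rewrite !liexx add0r addr0.
Qed.

Let tensD (a b : g) (r : SK) : a ⊗ r + b ⊗ r = (a + b) ⊗ r.
Proof. by rewrite -[a in RHS]scale1r tens_linl scale1r. Qed.

Let formC a b : B a b = B b a.
Proof. by rewrite hermitian_subproof expr0 mul1r. Qed.

Fact cur_lieC x y : cur_lie x y + cur_lie y x = 0.
Proof.
apply: (tensor_skew (h := cur_lie) cDl cDr) => J r J' s.
by rewrite !cur_lieE [(s : S) * _]mulrC tensD lieN tens0l.
Qed.

Fact cocycleC x y : cocycle x y + cocycle y x = 0.
Proof.
apply: (tensor_skew (h := cocycle) oDl oDr) => J r J' s.
by rewrite !cocycleE [B J' J]formC -scalerDr -kclsD -kdM kcls_exact scaler0.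
Qed.

Fact cur_lie_jacobi x y z :
  cur_lie x (cur_lie y z) + cur_lie y (cur_lie z x) + cur_lie z (cur_lie x y) = 0.
Proof.
apply: (tensor_cyclic (b := cur_lie) (h := cur_lie) cDl cDr cDl cDr) => J1 r1 J2 r2 J3 r3; rewrite !cur_lieE.

have -> : (r2 : S) * ((r3 : S) * r1) = (r1 : S) * ((r2 : S) * r3).
  by rewrite mulrA mulrC.
have -> : (r3 : S) * ((r1 : S) * r2) = (r1 : S) * ((r2 : S) * r3).
  by rewrite mulrA [(r3 : S) * _]mulrC -mulrA [(r3 : S) * _]mulrC.
by rewrite !tensD lie_jacobi tens0l.
Qed.

Fact cocycle_jacobi x y z :
  cocycle x (cur_lie y z) + cocycle y (cur_lie z x) + cocycle z (cur_lie x y) = 0.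
Proof.
apply: (tensor_cyclic (b := cur_lie) (h := cocycle) cDl cDr oDl oDr) => J1 r1 J2 r2 J3 r3; rewrite !cur_lieE !cocycleE.
have B31 : B J2 (lie J3 J1) = B J1 (lie J2 J3) by rewrite -form_inv formC.
have B12 : B J3 (lie J1 J2) = B J1 (lie J2 J3) by rewrite -form_inv formC.
rewrite B31 B12 -!scalerDr.
have := congr1 cl (@kd_cyclic K S eta r1 r2 r3).
by rewrite !kclsD kcls_exact addr0 => ->; rewrite scaler0.
Qed.

Local Notation L := (ghat B eta).
HB.instance Definition _ := GRing.Lmodule.on L.

Let bracket (x y : L) : L := (cur_lie x.1 y.1, cocycle x.1 y.1).

Fact ghat_linearl y : linear (bracket^~ y).
Proof. by move=> c u v; rewrite /bracket /= cur_lie_linearl cocycle_linearl. Qed.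
Fact ghat_linearr x : linear (bracket x).
Proof. by move=> c u v; rewrite /bracket /= cur_lie_linearr cocycle_linearr. Qed.
Fact ghat_xx x : bracket x x = 0.
Proof.
by congr pair; apply: double0; [apply: cur_lieC | apply: cocycleC].
Qed.
Fact ghat_jacobi x y z :
  bracket x (bracket y z) + bracket y (bracket z x) + bracket z (bracket x y) = 0.
Proof. by congr pair; [apply: cur_lie_jacobi | apply: cocycle_jacobi]. Qed.
HB.instance Definition _ :=
  isLie.Build K L ghat_linearl ghat_linearr ghat_xx ghat_jacobi.
End Ghat.

Lemma tensor_eq2 (K : comPzRingType) (M N : lmodType K) (W : zmodType)
    (p q : tensor M N -> tensor M N -> W) :
  (forall y, {morph (fun x => p x y) : a b / a + b}) ->
  (forall x, {morph (fun y => p x y) : a b / a + b}) ->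
  (forall y, {morph (fun x => q x y) : a b / a + b}) ->
  (forall x, {morph (fun y => q x y) : a b / a + b}) ->
  (forall m n m' n', p (tens m n) (tens m' n') = q (tens m n) (tens m' n')) ->
  forall x y, p x y = q x y.
Proof.
move=> pl pr ql qr pq x y.
have morph0 (h : tensor M N -> W) : {morph h : a b / a + b} -> h 0 = 0.
  by move=> hD; apply: (addIr (h 0)); rewrite -hD !add0r.
elim/tensor_ind: x => [|m n x IHx].
  by rewrite (morph0 _ (pl _)) (morph0 _ (ql _)).
rewrite pl ql {}IHx; congr (_ + _).
elim/tensor_ind: y => [|m' n' y IHy].
  by rewrite (morph0 _ (pr _)) (morph0 _ (qr _)).
by rewrite pr qr {}IHy pq.
Qed.

Section GhatMap.
Variables (K : numFieldType) (g : lieAlgType K) (B : invariant_form g).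
Variables (S S' : comPzRingType).
Variables (eta : {rmorphism K -> S}) (eta' : {rmorphism K -> S'}).
Variable phi : {rmorphism S -> S'}.

Definition cur_map : tensor g (restr eta S^o) -> tensor g (restr eta' S'^o) :=
  tlift (fun J (r : restr eta S^o) => tens J (phi r : restr eta' S'^o)).

Definition ghat_map (x : ghat B eta) : ghat B eta' :=
  (cur_map x.1, kaehlerH_map eta' phi x.2).

Hypothesis phi_eta : forall c, phi (eta c) = eta' c.

Let cur_map_bilin :
  bilin (fun (J : g) (r : restr eta S^o) => tens J (phi r : restr eta' S'^o)).
Proof.
split=> [r c u v|J c u v]; first exact: tens_linl.
rewrite -tens_linr; congr tens.
apply: etrans (rmorphD phi _ _) _; congr (_ + _).
by apply: etrans (rmorphM phi (eta c) u) _; rewrite phi_eta.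
Qed.

Lemma cur_map_tens J (r : S) :
  cur_map (tens J (r : restr eta S^o)) = tens J (phi r : restr eta' S'^o).
Proof. exact: tliftE. Qed.

Lemma cur_map_linear : linear cur_map.
Proof. exact: tlift_linear. Qed.

Lemma kaehlerH_map_linear : linear (kaehlerH_map eta' phi : kaehlerH eta -> _).
Proof.
move=> c; elim/mquot_ind=> u; elim/mquot_ind=> v.
have -> : c *: mcls (kaehler_exact (eta := eta)) u +
    mcls (kaehler_exact (eta := eta)) v = kcls (eta c *: (u : kaehler eta) + v).
  by rewrite kclsD kclsZ.
rewrite !kaehlerH_map_cls // kaehler_mapD // kclsD; congr (_ + _).
by rewrite kaehler_mapZ // -kclsZ -phi_eta.
Qed.

Lemma ghat_map_linear : linear ghat_map.
Proof.
by move=> c x y; rewrite /ghat_map /= cur_map_linear kaehlerH_map_linear.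
Qed.

Let mapD (U W : lmodType K) (f : U -> W) : linear f -> {morph f : a b / a + b}.
Proof. by move=> fl a b; have := fl 1 a b; rewrite !scale1r. Qed.
Let map0 (U W : lmodType K) (f : U -> W) : linear f -> f 0 = 0.
Proof. by move=> /mapD fD; apply: (addIr (f 0)); rewrite -fD !add0r. Qed.

Let compD (U V W : zmodType) (f : V -> W) (h : U -> V) :
  {morph f : a b / a + b} -> {morph h : a b / a + b} ->
  {morph (fun x => f (h x)) : a b / a + b}.
Proof. by move=> fD hD a b; rewrite hD fD. Qed.

Lemma ghat_map_lie x y : ghat_map (lie x y) = lie (ghat_map x) (ghat_map y).
Proof.
have CD := mapD cur_map_linear; have HD := mapD kaehlerH_map_linear.
case: x y => [x x'] [y y']; congr pair; rewrite {x' y'}/=.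
  apply: (@tensor_eq2 _ _ _ _ (fun x y => cur_map (cur_lie x y))
    (fun x y => cur_lie (cur_map x) (cur_map y))).
  - by move=> z; apply: compD CD (mapD (cur_lie_linearl _)).
  - by move=> z; apply: compD CD (mapD (cur_lie_linearr _)).
  - by move=> z; apply: (compD (mapD (cur_lie_linearl _)) CD).
  - by move=> z; apply: (compD (mapD (cur_lie_linearr _)) CD).
  - by move=> J r J' s; rewrite cur_lieE !cur_map_tens cur_lieE rmorphM.
apply: (@tensor_eq2 _ _ _ _ (fun x y => kaehlerH_map eta' phi (cocycle B x y))
  (fun x y => cocycle B (cur_map x) (cur_map y))).
- by move=> z; apply: compD HD (mapD (cocycle_linearl _ _)).
- by move=> z; apply: compD HD (mapD (cocycle_linearr _ _)).
- by move=> z; apply: (compD (mapD (cocycle_linearl _ _)) CD).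
- by move=> z; apply: (compD (mapD (cocycle_linearr _ _)) CD).
move=> J r J' s; rewrite !cur_map_tens !cocycleE -!kclsZ kaehlerH_map_cls //.
by rewrite kaehler_mapZ // kaehler_map_d // phi_eta.
Qed.
End GhatMap.

Lemma flift_monalgM (K : comPzRingType) (M : choiceType) (e : M)
    (op : Monoid.law e) (W : lmodType K) (mul : W -> W -> W) (phi : M -> W) :
  bilin mul -> (forall x y, phi (op x y) = mul (phi x) (phi y)) ->
  forall f g : monalg K op, flift phi (f * g) = mul (flift phi f) (flift phi g).
Proof.
move=> [mulDl mulDr] phiM f g.
have h0l w : mul 0 w = 0.
  by have := mulDl w (-1) 0 0; rewrite scaler0 addr0 scaleN1r addNr.
have h0r w : mul w 0 = 0.
  by have := mulDr w (-1) 0 0; rewrite scaler0 addr0 scaleN1r addNr.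
have phi0 : flift phi 0 = 0 by exact: linear0.
have phiD c u v : flift phi (c *: u + v) = c *: flift phi u + flift phi v.
  exact: linearP.
elim/freemod_ind: f => [|c x f IH]; first by rewrite mul0r phi0 h0l.
rewrite mulrDl -[X in X + _]monalg_scaleAl !phiD mulDl {}IH; congr (_ *: _ + _).
elim/freemod_ind: g => [|d y g IH]; first by rewrite mulr0 phi0 h0r.
rewrite mulrDr -[X in X + _]monalg_scaleAr !phiD mulDr {}IH; congr (_ *: _ + _).
by rewrite monalg_basisM !flift_fbasis phiM.
Qed.

Section EnvelopingAlgebra.
Variables (K : comPzRingType) (L : lieAlgType K).
Local Notation F := (monalg K (@cat L : Monoid.law [::])).
Local Notation δ w := (@fbasis K (seq L) w : F).

(* The free associative algebra on the set L, modulo linearity of the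
   generators, is the tensor algebra of L. *)
Variant uenv_rel : F -> Prop :=
| uenv_linear c x y : uenv_rel (δ [:: c *: x + y] - (c *: δ [:: x] + δ [:: y]))
| uenv_lie x y :
    uenv_rel (δ [:: x] * δ [:: y] - δ [:: y] * δ [:: x] - δ [:: lie x y]).

Variant uenv_ideal : F -> Prop :=
| uenv_two_sided a s b : uenv_rel s -> uenv_ideal (a * s * b).

Definition uenv := mquot uenv_ideal.
HB.instance Definition _ := GRing.Lmodule.on uenv.

Definition ucls (f : F) : uenv := mcls uenv_ideal f.

Lemma uenv_ind (P : uenv -> Prop) : (forall f, P (ucls f)) -> forall x, P x.
Proof. exact: mquot_ind. Qed.

Let one : uenv := ucls 1.
Definition uenv_mul (x y : uenv) : uenv := ucls (mrepr x * mrepr y).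

Let span_mull a f : span uenv_ideal f -> span uenv_ideal (a * f).
Proof.
elim=> [|c _ v [b s d rs] _ IH]; first by rewrite mulr0; apply: span0.
rewrite mulrDr; apply: spanD IH.
rewrite -monalg_scaleAr !mulrA; apply/spanZ/span_gen/uenv_two_sided; exact: rs.
Qed.
Let span_mulr a f : span uenv_ideal f -> span uenv_ideal (f * a).
Proof.
elim=> [|c _ v [b s d rs] _ IH]; first by rewrite mul0r; apply: span0.
rewrite mulrDl; apply: spanD IH.
rewrite -monalg_scaleAl -!mulrA mulrA; apply/spanZ/span_gen/uenv_two_sided; exact: rs.
Qed.
Let mulE f h : uenv_mul (ucls f) (ucls h) = ucls (f * h).
Proof.
have reprP k : span uenv_ideal (mrepr (ucls k) - k) by apply/mclsP; rewrite mreprK.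
apply/mclsP; rewrite -(subrKA (f * mrepr (ucls h))) -mulrBl -mulrBr.
by apply: spanD; [apply: span_mulr | apply: span_mull].
Qed.

Fact uenv_mulA : associative uenv_mul.
Proof.
by elim/uenv_ind=> x; elim/uenv_ind=> y; elim/uenv_ind=> z; rewrite !mulE mulrA.
Qed.
Fact uenv_mul1l : left_id one uenv_mul.
Proof. by elim/uenv_ind=> x; rewrite mulE mul1r. Qed.
Fact uenv_mul1r : right_id one uenv_mul.
Proof. by elim/uenv_ind=> x; rewrite mulE mulr1. Qed.
Lemma uclsD f h : ucls (f + h) = ucls f + ucls h. Proof. exact: mclsD. Qed.

Fact uenv_mulDl : left_distributive uenv_mul +%R.
Proof.
elim/uenv_ind=> x; elim/uenv_ind=> y; elim/uenv_ind=> z.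
by rewrite -[X in uenv_mul X _]uclsD !mulE mulrDl uclsD.
Qed.
Fact uenv_mulDr : right_distributive uenv_mul +%R.
Proof.
elim/uenv_ind=> x; elim/uenv_ind=> y; elim/uenv_ind=> z.
by rewrite -[X in uenv_mul _ X]uclsD !mulE mulrDr uclsD.
Qed.
HB.instance Definition _ := GRing.Zmodule_isPzRing.Build uenv
  uenv_mulA uenv_mul1l uenv_mul1r uenv_mulDl uenv_mulDr.

Lemma uclsM f h : ucls (f * h) = ucls f * ucls h. Proof. by rewrite [RHS]mulE. Qed.
Lemma ucls1 : ucls 1 = 1. Proof. by []. Qed.

Definition uinj (x : L) : uenv := ucls (δ [:: x]).

Lemma uinj_linear : linear uinj.
Proof.
move=> c x y; rewrite /uinj.
transitivity (ucls (c *: δ [:: x] + δ [:: y])); last exact: linearP.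
apply/mclsP/span_gen; rewrite -[X in uenv_ideal X]mul1r -[X in uenv_ideal X]mulr1.
exact/uenv_two_sided/uenv_linear.
Qed.

Lemma uinj_lie x y : uinj (lie x y) = uinj x * uinj y - uinj y * uinj x.
Proof.
rewrite /uinj -!uclsM.
transitivity (ucls (δ [:: x] * δ [:: y] - δ [:: y] * δ [:: x])); last exact: linearB.
apply/esym/mclsP/span_gen; rewrite -[X in uenv_ideal X]mul1r -[X in uenv_ideal X]mulr1.
exact/uenv_two_sided/uenv_lie.
Qed.

Lemma uclsZ c f : ucls (c *: f) = c *: ucls f. Proof. exact: linearZ. Qed.

Lemma uenv_scaleAl c (x y : uenv) : c *: (x * y) = (c *: x) * y.
Proof.
elim/uenv_ind: x => x; elim/uenv_ind: y => y.
by rewrite -uclsM -!uclsZ -uclsM; congr ucls; apply: monalg_scaleAl.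
Qed.

Lemma uenv_scaleAr c (x y : uenv) : c *: (x * y) = x * (c *: y).
Proof.
elim/uenv_ind: x => x; elim/uenv_ind: y => y.
by rewrite -uclsM -!uclsZ -uclsM; congr ucls; apply: monalg_scaleAr.
Qed.

Lemma uenv_bilin : bilin (fun x y : uenv => x * y).
Proof.
split=> [z c x y|z c x y]; first by rewrite mulrDl uenv_scaleAl.
by rewrite mulrDr uenv_scaleAr.
Qed.

Section Lift.
Variables (W : lmodType K) (mul : W -> W -> W) (phi : seq L -> W).
Hypothesis mul_bilin : bilin mul.
Hypothesis phiM : forall x y, phi (x ++ y) = mul (phi x) (phi y).
Hypothesis phi_linear : linear (fun x : L => phi [:: x]).
Hypothesis phi_lie : forall x y : L,
  phi [:: lie x y] = mul (phi [:: x]) (phi [:: y]) - mul (phi [:: y]) (phi [:: x]).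

Lemma uenv_lift_ideal s : uenv_ideal s -> flift phi s = 0.
Proof.
have fM := flift_monalgM (op := (@cat L : Monoid.law [::])) mul_bilin phiM.
have mul0l w : mul 0 w = 0.
  by have := mul_bilin.1 w (-1) 0 0; rewrite scaler0 addr0 scaleN1r addNr.
have mul0r' w : mul w 0 = 0.
  by have := mul_bilin.2 w (-1) 0 0; rewrite scaler0 addr0 scaleN1r addNr.
case=> a t b rt; rewrite [LHS]fM [X in mul X _]fM.
suff -> : flift phi t = 0 by rewrite mul0r' mul0l.
case: rt => [c x y|x y].
  by rewrite linearB linearP /= !flift_fbasis phi_linear subrr.
rewrite !linearB /= [X in X - _ - _]fM [X in _ - X - _]fM !flift_fbasis.
by rewrite phi_lie subrr.
Qed.

Lemma uenv_liftE f : mlift (flift phi) (ucls f) = flift phi f.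
Proof. exact: mlift_cls uenv_lift_ideal. Qed.
End Lift.

(* The action of U(L) on the trivial representation K: every nonempty word
   in L acts by zero. *)
Definition uaug : uenv -> K := mlift (flift (fun w : seq L => (w == [::])%:R : K^o)).

Lemma uaug_cls f : uaug (ucls f) = flift (fun w : seq L => (w == [::])%:R : K^o) f.
Proof.
apply: (@uenv_liftE K^o (fun x y => (x : K) * y)).
- split=> [z c x y|z c x y].
    by apply: etrans (mulrDl _ _ _) _; congr (_ + _); apply/esym/mulrA.
  by apply: etrans (mulrDr _ _ _) _; congr (_ + _); apply: mulrCA.
- by case=> [|x w] [|y w']; rewrite ?mulr0 ?mul0r ?mulr1.
- by move=> c x y; rewrite scaler0 addr0.
- by move=> x y; rewrite mulr0 subrr.
Qed.
End EnvelopingAlgebra.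

Definition uenv_map (K : comPzRingType) (L L' : lieAlgType K) (h : L -> L') :
    uenv L -> uenv L' :=
  mlift (flift (fun w : seq L => \prod_(x <- w) uinj (h x))).

Section EnvelopingMap.
Variables (K : comPzRingType) (L L' : lieAlgType K) (h : L -> L').
Hypothesis h_linear : linear h.
Hypothesis h_lie : forall x y, h (lie x y) = lie (h x) (h y).

Lemma uenv_map_cls f :
  uenv_map h (ucls f) = flift (fun w : seq L => \prod_(x <- w) uinj (h x)) f.
Proof.
apply: (uenv_liftE (uenv_bilin L')) => [x y|c x y|x y].
- by rewrite big_cat.
- by rewrite !big_seq1 h_linear uinj_linear.
- by rewrite !big_seq1 h_lie uinj_lie.
Qed.

Lemma uenv_mapM x y : uenv_map h (x * y) = uenv_map h x * uenv_map h y.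
Proof.
elim/uenv_ind: x => x; elim/uenv_ind: y => y; rewrite -uclsM !uenv_map_cls.
apply: (flift_monalgM (op := (@cat L : Monoid.law [::])) (uenv_bilin L')) => u v.
by rewrite big_cat.
Qed.

Lemma uenv_map_inj x : uenv_map h (uinj x) = uinj (h x).
Proof. by rewrite uenv_map_cls flift_fbasis big_seq1. Qed.
End EnvelopingMap.

Section Induced.
Variables (K : comPzRingType) (L L' : lieAlgType K) (h : L' -> L).
Local Notation "⟨ u , c ⟩" := (@fbasis K (uenv L * K)%type (u, c)).

Variant ind_rel : freemod K (uenv L * K)%type -> Prop :=
| ind_linl a u v c : ind_rel (⟨a *: u + v, c⟩ - (a *: ⟨u, c⟩ + ⟨v, c⟩))
| ind_linr a u b c : ind_rel (⟨u, a * b + c⟩ - (a *: ⟨u, b⟩ + ⟨u, c⟩))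
| ind_balanced u b c : ind_rel (⟨u * uenv_map h b, c⟩ - ⟨u, uaug b * c⟩).

(* U(L) tensored over U(L') with the trivial representation K of L', where U(L')
   acts on U(L) on the right through h. *)
Definition induced := mquot ind_rel.
HB.instance Definition _ := GRing.Lmodule.on induced.

Definition indt (u : uenv L) (c : K) : induced := mcls ind_rel ⟨u, c⟩.

Definition ind_vac : induced := indt 1 1.

Definition ind_act (x : L) : induced -> induced :=
  mlift (flift (fun p => indt (uinj x * p.1) p.2)).

Lemma indt_linl a u v c : indt (a *: u + v) c = a *: indt u c + indt v c.
Proof.
transitivity (mcls ind_rel (a *: ⟨u, c⟩ + ⟨v, c⟩)); last exact: linearP.
by apply/mclsP/span_gen/ind_linl.
Qed.

Lemma indt_linr a u b c : indt u (a * b + c) = a *: indt u b + indt u c.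
Proof.
transitivity (mcls ind_rel (a *: ⟨u, b⟩ + ⟨u, c⟩)); last exact: linearP.
by apply/mclsP/span_gen/ind_linr.
Qed.

Lemma indt_balanced u b c : indt (u * uenv_map h b) c = indt u (uaug b * c).
Proof. by apply/mclsP/span_gen/ind_balanced. Qed.

Fact ind_act_rel x s : ind_rel s ->
  flift (fun p => indt (uinj x * p.1) p.2) s = 0.
Proof.
case=> [a u v c|a u b c|u b c].
- rewrite linearB linearP /= !flift_fbasis /= mulrDr -uenv_scaleAr.
  by rewrite indt_linl subrr.
- by rewrite linearB linearP /= !flift_fbasis /= indt_linr subrr.
- by rewrite linearB /= !flift_fbasis /= mulrA indt_balanced subrr.
Qed.

Lemma ind_actE x u c : ind_act x (indt u c) = indt (uinj x * u) c.
Proof. by rewrite [LHS](mlift_cls _ (ind_act_rel x)) /= flift_fbasis. Qed.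

Lemma ind_act_linear x : linear (ind_act x).
Proof. exact: mlift_linear (@ind_act_rel x). Qed.

Lemma ind_act_vac x : linear h -> (forall y z, h (lie y z) = lie (h y) (h z)) ->
  ind_act (h x) ind_vac = 0.
Proof.
move=> hl hL; rewrite ind_actE mulr1 -uenv_map_inj // -[X in indt X]mul1r.
rewrite indt_balanced uaug_cls flift_fbasis /= mul0r.
by have := indt_linr (-1) 1 0 0; rewrite mulr0 addr0 scaleN1r addNr.
Qed.
End Induced.

Section AffineVertex.
Variables (K : numFieldType) (g : lieAlgType K) (B : invariant_form g).
Variables (A : comPzRingType) (eta : {rmorphism K -> A}).

Definition palg : {rmorphism K -> polyt A} := @pconst A \o eta.
Definition lalg : {rmorphism K -> laurent A} := @lconst A \o eta.

Definition ghatR := ghat B lalg.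
Definition ghatRplus := ghat B palg.
HB.instance Definition _ := LieAlgebra.on ghatR.
HB.instance Definition _ := LieAlgebra.on ghatRplus.

Definition ghat_incl : ghatRplus -> ghatR := ghat_map lalg (@polyt_incl A).

Lemma ghat_incl_linear : linear ghat_incl.
Proof. by apply: ghat_map_linear => c; apply: polyt_inclE. Qed.

Lemma ghat_incl_lie x y : ghat_incl (lie x y) = lie (ghat_incl x) (ghat_incl y).
Proof. by apply: ghat_map_lie => c; apply: polyt_inclE. Qed.

Definition affV := induced ghat_incl.
HB.instance Definition _ := GRing.Lmodule.on affV.

Definition affvac : affV := ind_vac ghat_incl.
Definition aff_act (x : ghatR) : affV -> affV := @ind_act _ _ _ ghat_incl x.

Definition Jt (J : g) (f : A) (n : int) : ghatR :=
  (tens J (lmono f n : restr lalg (laurent A)^o), 0).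

Definition ftdt (f : A) (n : int) : ghatR :=
  (0, kcls (lmono f n *: kd lalg (lmono 1 1))).

Definition tomega (n : int) (w : kaehler eta) : ghatR :=
  (0, kcls (lmono 1 n *: kaehler_map lalg (@lconst A) w)).
End AffineVertex.

Definition opcomm (V : zmodType) (a b : V -> V) : V -> V :=
  fun x => a (b x) - b (a x).

Record is_translation (K : numFieldType) (g : lieAlgType K) (B : invariant_form g)
    (A : comPzRingType) (eta : {rmorphism K -> A})
    (T : affV B eta -> affV B eta) : Prop := IsTranslation {
  translation_linear : linear T;
  translation_vac : T (affvac B eta) = 0;
  translation_J : forall (J : g) (f : A) (n : int) x,
    opcomm T (aff_act (Jt B eta J f n)) x =
    - n%:~R *: aff_act (Jt B eta J f (n - 1)) x;
  translation_dt : forall (f : A) (n : int) x,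
    opcomm T (aff_act (ftdt B eta f n)) x =
    - n%:~R *: aff_act (ftdt B eta f (n - 1)) x;
  translation_omega : forall (w : kaehler eta) (n : int) x,
    opcomm T (aff_act (tomega B n w)) x =
    - n%:~R *: aff_act (tomega B (n - 1) w) x
}.

(* A formal distribution with values in End V; a k is the coefficient of z^k
   (not of z^(-k-1)). *)
Definition distr (V : Type) := int -> V -> V.

Section FormalDistributions.
Variables (K : pzRingType) (V : lmodType K).

Definition dz (a : distr V) : distr V := fun k x => (k + 1)%:~R *: a (k + 1) x.

Definition distr_comm (a b : distr V) (m n : int) : V -> V := opcomm (a m) (b n).

(* Multiplication by (z - w) of a series with coefficients F m n of z^m w^n. *)
Definition mul_zw (F : int -> int -> V -> V) : int -> int -> V -> V :=
  fun m n x => F (m - 1) n x - F m (n - 1) x.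

Record is_vertex_algebra (vac : V) (T : V -> V) (Y : V -> distr V) : Prop :=
  IsVertexAlgebra {
  va_T_linear : linear T;
  va_Y_linear : forall k x, linear (fun v => Y v k x);
  va_Y_End : forall v k, linear (Y v k);
  va_field : forall v x, exists N : int, forall k, k < N -> Y v k x = 0;
  va_vacuum : forall k x, Y vac k x = if k == 0 then x else 0;
  va_creation : forall v, Y v 0 vac = v /\ forall k, k < 0 -> Y v k vac = 0;
  va_T_vac : T vac = 0;
  va_translation : forall v k x, opcomm T (Y v k) x = dz (Y v) k x;
  va_locality : forall v w, exists N : nat, forall m n x,
    iter N mul_zw (distr_comm (Y v) (Y w)) m n x = 0
}.
End FormalDistributions.

(* Main.v *)
Require Import Defs.
From HB Require Import structures.
From mathcomp Require Import all_boot all_order all_algebra.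
From mathcomp Require Import boolp functions zify.
From mathcomp Require Import reals complex.

Set Implicit Arguments.
Unset Strict Implicit.
Unset Printing Implicit Defensive.

Import Order.TTheory GRing.Theory Num.Theory.
Local Open Scope ring_scope.

(* The operator T is induced by the derivation -d/dt of R, which acts on the Lie
   algebra through the Lie derivative of differentials and preserves the
   subalgebra of A[t].

   For Y no basis of V is needed.  Call a field good if it is translation
   covariant, regular on the vacuum and local with the displayed fields.  Since
   the latter generate V from the vacuum, a good field a(z) is determined by
   its value a(0)|0> (Goddard).  By moving the operators J t^n, ... with n >= 0
   to the right, V is spanned by the words in creation operators, so it is
   enough to realise b_k v, for b a displayed field and b_k its coefficient of
   z^k with k >= 0, as the value of a good field: if a(z) has value v, this is
   the normally ordered product of the k-th derivative of b with a, divided by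
   k!.  Its locality is Dong's lemma, proved here in terms of coefficients:
   locality of a and b says that some iterated finite difference of
   [a_m, b_(s-m)] in m vanishes, and shifting the cut in the normally ordered
   sum only produces triple commutators [[b_j, c_n], a_m].  The uniqueness
   makes Y linear, and Dong's lemma once more makes its values pairwise local. *)

Lemma eq_fun2 (X Y Z : Type) (F G : X -> Y -> Z) :
  (forall x y, F x y = G x y) -> F = G.
Proof. by move=> FG; apply: funext => x; apply: funext. Qed.

Lemma eq_fun3 (W X Y Z : Type) (F G : W -> X -> Y -> Z) :
  (forall w x y, F w x y = G w x y) -> F = G.
Proof. by move=> FG; apply: funext => w; apply: eq_fun2. Qed.

(** * Commuting operators and finite sums *)

Section CommutingOperators.
Variables (U : zmodType).

Lemma iter_zmod_morphism (f : U -> U) n :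
  zmod_morphism f -> zmod_morphism (iter n f).
Proof. by move=> fB; elim: n => [|n IH] x y //=; rewrite IH fB. Qed.

Lemma zmod_morphism0 (W : zmodType) (f : U -> W) : zmod_morphism f -> f 0 = 0.
Proof. by move=> fB; rewrite -(subrr 0) fB subrr. Qed.

Lemma zmod_morphismD (W : zmodType) (f : U -> W) :
  zmod_morphism f -> {morph f : x y / x + y}.
Proof.
move=> fB x y; have fN : f (- y) = - f y.
  by rewrite -[- y]add0r fB (zmod_morphism0 fB) add0r.
by rewrite -[y in LHS]opprK fB fN opprK.
Qed.

Lemma iter_commute (f h : U -> U) n :
  (forall x, f (h x) = h (f x)) -> forall x, iter n f (h x) = h (iter n f x).
Proof. by move=> fh x; elim: n => //= n ->; rewrite fh. Qed.

Lemma iter_commute2 (f h : U -> U) m n :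
  (forall x, f (h x) = h (f x)) ->
  forall x, iter m f (iter n h x) = iter n h (iter m f x).
Proof.
move=> fh; apply: iter_commute => x; elim: n => //= n IH.
by rewrite fh IH.
Qed.

Lemma iter_eq0 (f : U -> U) n m x :
  zmod_morphism f -> iter n f x = 0 -> (n <= m)%N -> iter m f x = 0.
Proof.
move=> fB fx nm; rewrite -(subnK nm) iterD fx.
exact: (zmod_morphism0 (iter_zmod_morphism _ fB)).
Qed.

(* The binomial expansion of (p - q)^(a + b) lies in the ideal (p^a, q^b). *)
Lemma iter_sub_eq0 (p q : U -> U) a b x :
  zmod_morphism p -> zmod_morphism q -> (forall y, p (q y) = q (p y)) ->
  iter a p x = 0 -> iter b q x = 0 ->
  iter (a + b) (fun y => p y - q y) x = 0.
Proof.
move=> pB qB pq; have rB : zmod_morphism (fun y => p y - q y).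
  by move=> y z; rewrite pB qB !opprD !opprK addrACA.
have r0 n : iter n (fun y => p y - q y) 0 = 0.
  exact: (zmod_morphism0 (iter_zmod_morphism _ rB)).
move: {2}(a + b)%N (erefl (a + b)%N) => n; elim: n a b x => [|n IH] a b x.
  by move=> /eqP; rewrite addn_eq0 => /andP[/eqP-> /eqP->].
case: a => [|a] abn; first by move=> /= ->; rewrite r0.
case: b abn => [|b] abn px; first by move: px => _ x0; rewrite [x]x0 r0.
move=> qx; rewrite abn iterSr (iter_zmod_morphism _ rB).
have -> : iter n (fun y => p y - q y) (p x) = 0.
  have -> : n = (a + b.+1)%N by move: abn; rewrite addSn; case.
  apply: IH; [by move: abn; rewrite addSn; case | by rewrite -iterSr |].
  by rewrite iter_commute ?qx ?(zmod_morphism0 pB).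
rewrite sub0r.
have -> : n = (a.+1 + b)%N by move: abn; rewrite addnS; case.
rewrite IH ?oppr0 -?iterSr //; first by move: abn; rewrite addnS; case.
by rewrite iter_commute // px (zmod_morphism0 qB).
Qed.

End CommutingOperators.

Section FiniteSums.
Variable V : zmodType.
Implicit Types f g : nat -> V.

Definition ev0 f := exists N : nat, forall n, (N <= n)%N -> f n = 0.

(** The sums in a normally ordered product are finite on each vector, but the number of terms
    depends on that vector, so a bound is extracted by choice. Sequences that are not eventually
    zero get the default value 0. *)
Definition fsum f : V :=
  if pselect (ev0 f) is left h then \sum_(i < projT1 (cid h)) f i else 0.

Lemma fsumE f N : (forall n, (N <= n)%N -> f n = 0) -> fsum f = \sum_(i < N) f i.
Proof.
move=> fN; rewrite /fsum; case: pselect => [h|[]]; last by exists N.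
case: (cid h) => M /= fM {h}.
wlog NM : N M fN fM / (N <= M)%N.
  by case: (leqP N M) => [NM|/ltnW NM] H; [|apply/esym]; apply: H.
rewrite -!(big_mkord xpredT f) (big_cat_nat (leq0n N) NM) /=.
by rewrite [X in _ + X]big_nat_cond [X in _ + X]big1 ?addr0 // => i /andP[/andP[/fN]].
Qed.

Lemma ev0D f g : ev0 f -> ev0 g -> ev0 (fun n => f n + g n).
Proof.
move=> [N fN] [M gM]; exists (maxn N M) => n; rewrite geq_max => /andP[Nn Mn].
by rewrite fN // gM // addr0.
Qed.

Lemma ev0_shift f : ev0 f -> ev0 (fun n => f n.+1).
Proof. by move=> [N fN]; exists N => n Nn; rewrite fN // leqW. Qed.

Lemma ev0_morph (W : zmodType) (h : W -> V) (f : nat -> W) :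
  (exists N : nat, forall n, (N <= n)%N -> f n = 0) -> h 0 = 0 ->
  ev0 (fun n => h (f n)).
Proof. by move=> [N fN] h0; exists N => n Nn; rewrite fN. Qed.

Lemma fsum0 f : (forall n, f n = 0) -> fsum f = 0.
Proof. by move=> f0; rewrite (@fsumE _ 0) ?big_ord0. Qed.

Lemma fsumD f g : ev0 f -> ev0 g -> fsum (fun n => f n + g n) = fsum f + fsum g.
Proof.
move=> [N fN] [M gM].
have fX n : (maxn N M <= n)%N -> f n = 0 by rewrite geq_max => /andP[/fN].
have gX n : (maxn N M <= n)%N -> g n = 0 by rewrite geq_max => /andP[_ /gM].
rewrite (fsumE fX) (fsumE gX) (@fsumE _ (maxn N M)) ?big_split // => n Xn.
by rewrite fX // gX // addr0.
Qed.

Lemma fsumS f : ev0 f -> fsum f = f 0%N + fsum (fun n => f n.+1).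
Proof.
move=> [N fN]; rewrite (@fsumE f N.+1) => [|n /ltnW/fN //].
rewrite (@fsumE (fun n => f n.+1) N) => [|n Nn]; last by rewrite fN // leqW.
by rewrite big_ord_recl.
Qed.

End FiniteSums.

Lemma fsum_morph (V W : zmodType) (h : V -> W) (f : nat -> V) :
  zmod_morphism h -> ev0 f -> h (fsum f) = fsum (fun n => h (f n)).
Proof.
move=> hB [N fN]; have h0 := zmod_morphism0 hB.
rewrite (fsumE fN) (@fsumE _ _ N) => [|n /fN -> //].
by apply: big_morph => // x y; apply: zmod_morphismD.
Qed.

Lemma fsumB (V : zmodType) (f g : nat -> V) : ev0 f -> ev0 g ->
  fsum (fun n => f n - g n) = fsum f - fsum g.
Proof.
move=> f0 g0; have oB : zmod_morphism (-%R : V -> V).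
  by move=> x y; rewrite opprB opprK addrC.
by rewrite (fsum_morph oB g0) -fsumD //; apply: (ev0_morph g0); rewrite oppr0.
Qed.

(** * Multiplication by z - w on families of coefficients *)

Section ShiftOperators.
Variable V : zmodType.

(** This is [mul_zw] with the vector evaluated beforehand, so that the values may lie in any abelian
    group. *)
Definition delta (F : int -> int -> V) : int -> int -> V :=
  fun m n => F (m - 1) n - F m (n - 1).

Lemma fun2B (F G : int -> int -> V) m n : (F - G) m n = F m n - G m n.
Proof. by []. Qed.

Lemma fun2D (F G : int -> int -> V) m n : (F + G) m n = F m n + G m n.
Proof. by []. Qed.

Lemma delta_morph : zmod_morphism delta.
Proof.
move=> F G; apply: eq_fun2 => m n.
by rewrite /delta /= !opprD !opprK addrACA.
Qed.

(** Exchanging the variables only changes the sign of z - w. *)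
Lemma iter_delta_swap N F :
  iter N delta F = 0 -> iter N delta (fun m n => F n m) = 0.
Proof.
elim: N F => [|N IH] F.
  by move=> /= F0; apply: eq_fun2 => m n; rewrite F0.
rewrite !iterSr => /IH F0.
have -> : delta (fun m n => F n m) = 0 - (fun m n => delta F n m).
  apply: eq_fun2 => m n.
  by rewrite /delta /= sub0r opprB.
have iB := iter_zmod_morphism N delta_morph.
by rewrite iB (zmod_morphism0 iB) F0 subr0.
Qed.

(** Along the antidiagonal m + n = s, [delta] is a finite difference in m. By induction that
    difference vanishes, so F is constant there, and the constant is read off at large m. *)
Lemma iter_delta_trunc N F (s k : int) :
  iter N delta F = 0 -> (forall m : int, k < m -> F m (s - m) = 0) ->
  forall m, F m (s - m) = 0.
Proof.
elim: N F s k => [|N IH] F s k; first by move=> /= -> .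
rewrite iterSr => F0 Fk.
have dF (m : int) : F (m - 1) (s - (m - 1)) = F m (s - m).
  apply/eqP; rewrite -subr_eq0; apply/eqP.
  have -> : s - (m - 1) = s + 1 - m by lia.
  have -> : s - m = s + 1 - m - 1 by lia.
  (* The difference also involves the index m - 1, which moves the threshold from k to k + 1. *)
  move: m; apply: (IH _ _ (k + 1) F0) => m km; rewrite /delta.
  have -> : s + 1 - m = s - (m - 1) by lia.
  have -> : s - (m - 1) - 1 = s - m by lia.
  by rewrite !Fk ?subr0 //; lia.
move=> m; have dFn n : F m (s - m) = F (m + n%:Z) (s - (m + n%:Z)).
  elim: n => [|n ->]; first by rewrite addr0.
  rewrite -[RHS]dF; have -> // : m + n.+1%:Z - 1 = m + n by lia.
(* For m <= k this many steps lead from m to k + 1; for larger m they stay beyond the threshold. *)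
by rewrite (dFn (absz (k - m + 1))) Fk //; lia.
Qed.

End ShiftOperators.

Lemma iter_delta_translate (V : zmodType) (F : int -> int -> V) N p q :
  iter N (@delta V) (fun m n => F (m + p) (n + q)) =
  fun m n => iter N (@delta V) F (m + p) (n + q).
Proof.
elim: N => //= N ->.
by apply: eq_fun2 => m n; rewrite /delta !(addrAC _ (- 1)).
Qed.

Lemma iter_delta_fsum (V : zmodType) (F : nat -> int -> int -> V) N :
  (forall m n, ev0 (fun j => F j m n)) -> (forall j, iter N (@delta V) (F j) = 0) ->
  iter N (@delta V) (fun m n => fsum (fun j => F j m n)) = 0.
Proof.
elim: N F => [|N IH] F Fe F0.
  apply: eq_fun2 => m n; apply: fsum0 => j.
  by have /(congr1 (fun G => G m n)) := F0 j.
rewrite iterSr.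
have -> : delta (fun m n => fsum (fun j => F j m n)) =
    (fun m n => fsum (fun j => delta (F j) m n)).
  by apply: eq_fun2 => m n; rewrite /delta fsumB.
apply: IH => [m n|j]; last by rewrite -iterSr.
by apply: ev0D => //; apply: (ev0_morph (Fe _ _)); rewrite oppr0.
Qed.

Lemma iter_delta_morph (V W : zmodType) (f : W -> V) (F : int -> int -> W) N :
  zmod_morphism f ->
  iter N (@delta V) (fun m n => f (F m n)) = fun m n => f (iter N (@delta W) F m n).
Proof.
move=> fB; elim: N => //= N ->.
by apply: eq_fun2 => m n; rewrite /delta fB.
Qed.

(** * Normally ordered products and Dong's lemma *)

Lemma linear_zmod (K : pzRingType) (U W : lmodType K) (f : U -> W) :
  linear f -> zmod_morphism f.
Proof. by move=> fl x y; have := fl (-1) y x; rewrite !scaleN1r !(addrC (- _)). Qed.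

Lemma linear_scale (K : pzRingType) (U W : lmodType K) (f : U -> W) c x :
  linear f -> f (c *: x) = c *: f x.
Proof.
move=> fl; have := fl c x 0.
by rewrite (zmod_morphism0 (linear_zmod fl)) !addr0.
Qed.

Section Locality.
Variable V : zmodType.
Implicit Types a b c : distr V.

Definition mutually_local a b := exists N : nat, forall x,
  iter N (@delta V) (fun m n => opcomm (a m) (b n) x) = 0.

Definition truncated a := forall x, exists N : int, forall k, k < N -> a k x = 0.

Definition additive_modes a := forall k, zmod_morphism (a k).

Lemma local_sym a b : mutually_local a b -> mutually_local b a.
Proof.
move=> [N ab]; exists N => x.
have -> : (fun m n => opcomm (b m) (a n) x) =
    0 - (fun m n => (fun m n => opcomm (a m) (b n) x) n m).
  by apply: eq_fun2 => m n; rewrite /= sub0r opprB.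
have iB := iter_zmod_morphism N (@delta_morph V).
by rewrite iB (zmod_morphism0 iB) iter_delta_swap ?subr0.
Qed.

Lemma ev0_neg a (m : int) x : truncated a -> ev0 (fun j : nat => a (m - j%:Z) x).
Proof.
move=> /(_ x)[N aN]; exists (absz (m - N)).+1 => j Nj; apply: aN; lia.
Qed.

(* With G constant this is the normally ordered product of the series G and a,
   G j being the coefficient of z^j. *)
Definition wsum (G : int -> V -> V) a (m : int) (x : V) : V :=
  fsum (fun j : nat => G j%:Z (a (m - j%:Z) x) + a (m + j%:Z + 1) (G (- j%:Z - 1) x)).

Definition nprod b a : distr V := wsum b a.

Lemma wsum0 (G : int -> V -> V) a m x : additive_modes a ->
  (forall j y, G j y = 0) -> wsum G a m x = 0.
Proof.
by move=> aB G0; apply: fsum0 => j; rewrite !G0 (zmod_morphism0 (aB _)) addr0.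
Qed.

Section WSum.
Variable (a : distr V).
Hypotheses (aB : additive_modes a) (at0 : truncated a).

Lemma wsum_ev0l (G : int -> V -> V) m x : (forall j, zmod_morphism (G j)) ->
  ev0 (fun j : nat => G j%:Z (a (m - j%:Z) x)).
Proof.
move=> GB; have [N aN] := ev0_neg m x at0; exists N => j Nj.
by rewrite aN // (zmod_morphism0 (GB _)).
Qed.

Lemma wsum_ev0r (G : distr V) (m : int) x : truncated G ->
  ev0 (fun j : nat => a (m + j%:Z + 1) (G (- j%:Z - 1) x)).
Proof.
move=> Gt; have [N GN] := ev0_neg (-1) x Gt; exists N => j Nj.
by rewrite [- _ - 1]addrC GN // (zmod_morphism0 (aB _)).
Qed.

Lemma wsumE (G : distr V) m x : additive_modes G -> truncated G ->
  wsum G a m x = fsum (fun j : nat => G j%:Z (a (m - j%:Z) x)) +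
    fsum (fun j : nat => a (m + j%:Z + 1) (G (- j%:Z - 1) x)).
Proof. by move=> GB Gt; rewrite -fsumD //; [apply: wsum_ev0l | apply: wsum_ev0r]. Qed.

(* Moving the cut between the two halves of the sum produces the commutator. *)
Lemma wsum_shift (G : distr V) m x : additive_modes G -> truncated G ->
  wsum (fun j => G (j - 1)) a m x =
  wsum G a (m - 1) x + opcomm (G (-1)) (a m) x.
Proof.
move=> GB Gt; have GB' j : zmod_morphism (G (j - 1)) by exact: GB.
have Gt' : truncated (fun j => G (j - 1)).
  by move=> y; have [N GN] := Gt y; exists N => k kN; apply: GN; lia.
rewrite !wsumE // (fsumS (wsum_ev0l m x GB')) (fsumS (wsum_ev0r (m - 1) x Gt)).
have -> : 0%:Z - 1 = -1 by [].
have -> : m - 0%:Z = m by lia.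
have -> : m - 1 + 0%:Z + 1 = m by lia.
rewrite /opcomm.
have -> : (fun n : nat => G (n.+1%:Z - 1) (a (m - n.+1%:Z) x)) =
    (fun n : nat => G n%:Z (a (m - 1 - n%:Z) x)).
  by apply: funext => n; congr (G _ (a _ x)); lia.
have -> : (fun n : nat => a (m - 1 + n.+1%:Z + 1) (G (- n.+1%:Z - 1) x)) =
    (fun n : nat => a (m + n%:Z + 1) (G (- n%:Z - 1 - 1) x)).
  by apply: funext => n; congr (a _ (G _ x)); lia.
by rewrite [RHS]addrC [X in _ = _ + X]addrCA [RHS]addrA subrK addrA.
Qed.

Lemma wsumB (G G' : distr V) m x : additive_modes G -> truncated G ->
  additive_modes G' -> truncated G' ->
  wsum (fun j y => G j y - G' j y) a m x = wsum G a m x - wsum G' a m x.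
Proof.
move=> GB Gt GB' Gt'; rewrite /wsum -fsumB; first last.
- by apply: ev0D; [apply: wsum_ev0l | apply: wsum_ev0r].
- by apply: ev0D; [apply: wsum_ev0l | apply: wsum_ev0r].
by congr fsum; apply: funext => j; rewrite aB opprD addrACA.
Qed.

(** One factor z - w in the outer variables replaces G by its own difference [dG], at the price of
    the commutator [G_(-1), a] created by shifting the cut. That commutator dies under L further
    factors, and [dG] needs one factor fewer than G, so induction on N applies; for N = 0 the family
    G is zero. *)
Lemma wsum_local (G : int -> int -> V -> V) x N L :
  (forall n, additive_modes (G^~ n)) -> (forall n, truncated (G^~ n)) ->
  (forall y, iter N (@delta V) (fun j n => G j n y) = 0) ->
  (forall j, iter L (@delta V) (fun m n => opcomm (G j n) (a m) x) = 0) ->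
  iter (N + L) (@delta V) (fun m n => wsum (G^~ n) a m x) = 0.
Proof.
have i0 M := zmod_morphism0 (iter_zmod_morphism M (@delta_morph V)).
elim: N G => [|N IH] G GB Gt G0 GL.
  have -> : (fun m n => wsum (G^~ n) a m x) = 0; last exact: i0.
  apply: eq_fun2 => m n; apply: wsum0 => // j y.
  by have /(congr1 (fun F => F j n)) := G0 y.
have GBs n : additive_modes (fun j => G (j - 1) n) by move=> j; apply: (GB n).
have Gts n : truncated (fun j => G (j - 1) n).
  by move=> y; have [M GM] := Gt n y; exists M => k kM; apply: GM; lia.
pose dG j n y := G (j - 1) n y - G j (n - 1) y.
rewrite addSn iterSr.
have -> : delta (fun m n => wsum (G^~ n) a m x) =
    (fun m n => wsum (dG^~ n) a m x) - (fun m n => opcomm (G (-1) n) (a m) x).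
  apply: eq_fun2 => m n; rewrite /delta.
  transitivity (wsum (dG^~ n) a m x - opcomm (G (-1) n) (a m) x); last by [].
  have -> : wsum (dG^~ n) a m x = wsum (fun j => G (j - 1) n) a m x -
      wsum (G^~ (n - 1)) a m x by apply: wsumB.
  rewrite (wsum_shift (G := G^~ n)) //.
  by rewrite addrAC addrK.
rewrite (iter_zmod_morphism _ (@delta_morph V)).
rewrite (iter_eq0 (@delta_morph V) (GL (-1))) ?leq_addl // subr0.
apply: IH => [n k y z|n y|y|j].
- by rewrite /dG GB (GB (n - 1)) !opprD !opprK addrACA.
- have [M GM] := Gts n y; have [M' GM'] := Gt (n - 1) y.
  exists (Order.min M M') => k; rewrite lt_min => /andP[kM kM'].
  by rewrite /dG GM // GM' // subrr.
- by have := G0 y; rewrite iterSr.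
(* The exponent L does not grow: the commutator of [dG] with a is a difference of two commutators of
   G with a, one of them translated in n. *)
have -> : (fun m n => opcomm (dG j n) (a m) x) =
    (fun m n => opcomm (G (j - 1) n) (a m) x) -
    (fun m n => (fun m n => opcomm (G j n) (a m) x) (m + 0) (n - 1)).
  apply: eq_fun2 => m n.
  by rewrite fun2B /opcomm /dG aB addr0 !opprD !opprK addrACA.
rewrite (iter_zmod_morphism _ (@delta_morph V)) GL sub0r.
have /= -> := iter_delta_translate (fun m n => opcomm (G j n) (a m) x) L 0 (-1).
by rewrite GL oppr0.
Qed.
End WSum.

Section Dong.
Variables a b c : distr V.
Hypotheses (aB : additive_modes a) (bB : additive_modes b) (cB : additive_modes c).
Hypotheses (at0 : truncated a) (bt : truncated b) (ct : truncated c).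

(* Both (z - u)^N and (z - w)^N (w - u)^N annihilate [[b(z), c(u)], a(w)], the
   second one by the Jacobi identity, and w - u = (z - u) - (z - w). *)
Lemma triple_local : mutually_local b a -> mutually_local b c -> mutually_local a c ->
  exists L, forall j x,
    iter L (@delta V) (fun m n => opcomm (opcomm (b j) (c n)) (a m) x) = 0.
Proof.
have dB := @delta_morph V; have iB M := iter_zmod_morphism M dB.
move=> [N1 ba] [N2 bc] [N3 ac]; pose N := maxn N1 (maxn N2 N3).
have {}ba x := iter_eq0 dB (ba x) (leq_maxl _ _ : N1 <= N)%N.
have {}bc x : iter N (@delta V) (fun m n => opcomm (b m) (c n) x) = 0.
  by apply: iter_eq0 (bc x) _ => //; rewrite /N; lia.
have {}ac x : iter N (@delta V) (fun m n => opcomm (a m) (c n) x) = 0.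
  by apply: iter_eq0 (ac x) _ => //; rewrite /N; lia.
(* With j, m, n the exponents of z, w, u, the operators [dbc], [dba], [dac] below multiply by z - u,
   z - w, w - u. N copies of [dac] kill [K1]; in the expansion of the other 2N, each term contains N
   copies of [dbc], which kill [H], or N copies of [dba], which kill [K2]. *)
exists (N + N + N)%N => j x.
pose dbc (F : int -> int -> int -> V) j m n := F (j - 1) m n - F j m (n - 1).
pose dba (F : int -> int -> int -> V) j m n := F (j - 1) m n - F j (m - 1) n.
pose dac F := dbc F - dba F.
have bcB : zmod_morphism dbc.
  move=> F G; apply: eq_fun3 => k m n.
  by rewrite /dbc /= !opprD !opprK addrACA.
have baB : zmod_morphism dba.
  move=> F G; apply: eq_fun3 => k m n.
  by rewrite /dba /= !opprD !opprK addrACA.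
have acB : zmod_morphism dac.
  by move=> F G; rewrite /dac bcB baB !opprD !opprK addrACA.
have bcba F : dbc (dba F) = dba (dbc F).
  apply: eq_fun3 => k m n; rewrite /dba /dbc !opprD !opprK.
  by rewrite addrACA.
have baac F : dba (dac F) = dac (dba F) by rewrite /dac baB bcba.
have bcE M F : iter M dbc F =
    fun j m n => iter M (@delta V) (fun j n => F j m n) j n.
  by elim: M => //= M ->; apply: eq_fun3 => k m n.
have baE M F : iter M dba F =
    fun j m n => iter M (@delta V) (fun j m => F j m n) j m.
  by elim: M => //= M ->; apply: eq_fun3 => k m n.
have acE M F : iter M dac F =
    fun j m n => iter M (@delta V) (fun m n => F j m n) m n.
  elim: M => //= M ->; apply: eq_fun3 => k m n.
  by rewrite /dac /dba /dbc /delta /= opprB addrC addrA subrK.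
pose H j m n := opcomm (opcomm (b j) (c n)) (a m) x.
pose K1 j m n := opcomm (a m) (c n) (b j x) - b j (opcomm (a m) (c n) x).
pose K2 j m n := c n (opcomm (b j) (a m) x) - opcomm (b j) (a m) (c n x).
(* The Jacobi identity in the form [[b, c], a] = [[a, c], b] - [c, [b, a]]. *)
have HK : H = K1 - K2.
  apply: eq_fun3 => k m n; transitivity (K1 k m n - K2 k m n); last by [].
  rewrite /H /K1 /K2 /opcomm aB bB cB !opprB.
  rewrite [in RHS](addrC (_ - c n _)) [in RHS]addrACA !subrKA.
  by rewrite [X in _ + X = _]addrC addrACA [X in _ + X = _]addrC.
have bcH : iter N dbc H = 0.
  rewrite bcE; apply: eq_fun3 => k m n.
  have -> : (fun j n => H j m n) = (fun j n => opcomm (b j) (c n) (a m x)) -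
    (fun j n => a m (opcomm (b j) (c n) x)) by [].
  by rewrite iB iter_delta_morph // !bc fun2B (zmod_morphism0 (aB m)) subrr.
have acK : iter N dac K1 = 0.
  rewrite acE; apply: eq_fun3 => k m n.
  have -> : (fun m n => K1 k m n) = (fun m n => opcomm (a m) (c n) (b k x)) -
    (fun m n => b k (opcomm (a m) (c n) x)) by [].
  by rewrite iB iter_delta_morph // !ac fun2B (zmod_morphism0 (bB k)) subrr.
have baK : iter N dba K2 = 0.
  rewrite baE; apply: eq_fun3 => k m n.
  have -> : (fun k m => K2 k m n) = (fun k m => c n (opcomm (b k) (a m) x)) -
    (fun k m => opcomm (b k) (a m) (c n x)) by [].
  by rewrite iB iter_delta_morph // !ba fun2B (zmod_morphism0 (cB n)) subrr.
suff /(congr1 (fun F => F j)) : iter (N + N + N) dac H = 0 by rewrite acE.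
rewrite iterD; apply: iter_sub_eq0 => //.
  rewrite (iter_commute2 _ _ (f := dbc)) => [|F]; last by rewrite /dac bcB bcba.
  by rewrite bcH (zmod_morphism0 (iter_zmod_morphism _ acB)).
rewrite HK (iter_zmod_morphism _ acB) acK sub0r -sub0r (iter_zmod_morphism _ baB).
rewrite (zmod_morphism0 (iter_zmod_morphism _ baB)) iter_commute2 // baK.
by rewrite (zmod_morphism0 (iter_zmod_morphism _ acB)) subr0.
Qed.

Lemma opcomm_additive j n : zmod_morphism (opcomm (b j) (c n)).
Proof.
by move=> x y; rewrite /opcomm cB !bB cB !opprD !opprK addrACA.
Qed.

Lemma opcomm_truncated n : truncated (fun j => opcomm (b j) (c n)).
Proof.
move=> x; have [M bM] := bt x; have [M' bM'] := bt (c n x).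
exists (Order.min M M') => k; rewrite lt_min => /andP[kM kM'].
by rewrite /opcomm bM // bM' // (zmod_morphism0 (cB _)) subrr.
Qed.

Lemma nprod_ev0 m n x :
  ev0 (fun j : nat => b j%:Z (opcomm (a (m - j%:Z)) (c n) x) +
    opcomm (a (m + j%:Z + 1)) (c n) (b (- j%:Z - 1) x)).
Proof.
have [N1 a1] := ev0_neg m x at0; have [N2 a2] := ev0_neg m (c n x) at0.
have [N3 b3] := ev0_neg (-1) x bt; exists (maxn N1 (maxn N2 N3)) => j Nj.
rewrite /opcomm a1 ?a2 ?[- _ - 1]addrC ?b3; try lia.
by rewrite !(zmod_morphism0 (cB _)) !(zmod_morphism0 (aB _))
  (zmod_morphism0 (cB _)) subrr (zmod_morphism0 (bB _)) addr0.
Qed.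

(** By the Leibniz rule c meets either a or b. The terms where it meets b again form a cut sum, with
    [b_j, c_n] in place of b_j, which is why [wsum] allows a general G. *)
Lemma nprod_opcomm m n x : opcomm (nprod b a m) (c n) x =
  fsum (fun j : nat => b j%:Z (opcomm (a (m - j%:Z)) (c n) x) +
    opcomm (a (m + j%:Z + 1)) (c n) (b (- j%:Z - 1) x)) +
  wsum (fun j => opcomm (b j) (c n)) a m x.
Proof.
have be y : ev0 (fun j : nat => b j%:Z (a (m - j%:Z) y) +
    a (m + j%:Z + 1) (b (- j%:Z - 1) y)).
  by apply: ev0D; [exact: (wsum_ev0l at0) | exact: (wsum_ev0r aB)].
rewrite {1}/opcomm /nprod /wsum (fsum_morph (cB n) (be x)).
rewrite -fsumB //; last by apply: (ev0_morph (be x)); apply: zmod_morphism0.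
rewrite -fsumD; first last.
- apply: ev0D.
    apply: (@wsum_ev0l a at0 (fun j => opcomm (b j) (c n))) => j.
    exact: opcomm_additive.
  exact: (@wsum_ev0r a aB (fun j => opcomm (b j) (c n)) _ _ (opcomm_truncated n)).
- exact: nprod_ev0.
congr fsum; apply: funext => j; rewrite (zmod_morphismD (cB n)) /opcomm aB bB.
by rewrite [RHS]addrACA subrKA [X in _ = _ + X]addrC subrKA opprD addrACA.
Qed.

(** Dong's lemma. The first sum of [nprod_opcomm] is local term by term, with the exponent of a and
    c. The second is covered by [wsum_local], where [triple_local] supplies an exponent L valid for
    all j. *)
Lemma local_nprod : mutually_local b a -> mutually_local b c -> mutually_local a c ->
  mutually_local (nprod b a) c.
Proof.
move=> ba bc ac; have [L tL] := triple_local ba bc ac.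
have dB := @delta_morph V; have iB M := iter_zmod_morphism M dB.
case: bc ac => [N bc] [N' ac].
exists (maxn N' (N + L)) => x.
have -> : (fun m n => opcomm (nprod b a m) (c n) x) =
    (fun m n => fsum (fun j : nat => b j%:Z (opcomm (a (m - j%:Z)) (c n) x) +
      opcomm (a (m + j%:Z + 1)) (c n) (b (- j%:Z - 1) x))) +
    (fun m n => wsum (fun j => opcomm (b j) (c n)) a m x).
  by apply: eq_fun2 => m n; apply: nprod_opcomm.
rewrite (zmod_morphismD (iB _)).
rewrite [X in _ + X](@iter_eq0 _ _ (N + L)%N) ?leq_maxr // ?addr0; last first.
  apply: (@wsum_local a aB at0 (fun j n => opcomm (b j) (c n))) => // n.
    by move=> j; apply: opcomm_additive.
  exact: opcomm_truncated.
apply: (@iter_eq0 _ _ N') => //; last exact: leq_maxl.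
apply: (iter_delta_fsum (F := fun j m n => b j%:Z (opcomm (a (m - j%:Z)) (c n) x) +
  opcomm (a (m + j%:Z + 1)) (c n) (b (- j%:Z - 1) x))) => [m n|j].
  exact: nprod_ev0.
pose F y m n := opcomm (a m) (c n) y.
have -> : (fun m n => b j%:Z (opcomm (a (m - j%:Z)) (c n) x) +
    opcomm (a (m + j%:Z + 1)) (c n) (b (- j%:Z - 1) x)) =
  (fun m n => b j%:Z (F x (m + - j%:Z) (n + 0))) +
  (fun m n => F (b (- j%:Z - 1) x) (m + (j%:Z + 1)) (n + 0)).
  by apply: eq_fun2 => m n; rewrite fun2D /F !addr0 (addrA m).
rewrite (zmod_morphismD (iB _)) iter_delta_morph // !iter_delta_translate !ac.
by apply: eq_fun2 => m n; rewrite fun2D (zmod_morphism0 (bB _)) addr0.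
Qed.
End Dong.

End Locality.

(** * Reconstruction *)

Section StateFields.
Variables (K : numFieldType) (V : lmodType K) (vac : V) (T : V -> V).
Hypotheses (T_linear : linear T) (T_vac : T vac = 0).
Implicit Types a b c : distr V.

(** Locality is kept apart from the other properties of a good field, because the class of fields to
    be local with varies in the sequel. *)
Record state_field a : Prop := StateField {
  sf_linear : forall k, linear (a k);
  sf_truncated : truncated a;
  sf_translation : forall k x, opcomm T (a k) x = dz a k x;
  sf_creation : forall k, k < 0 -> a k vac = 0
}.

Definition distr_id : distr V := fun k x => if k == 0 then x else 0.

Definition distr_lin (e : K) a b : distr V := fun k x => e *: a k x + b k x.

Lemma sf_additive a : state_field a -> additive_modes a.
Proof. by move=> [al _ _ _] k; apply: linear_zmod. Qed.

Lemma state_field_id : state_field distr_id.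
Proof.
split=> [k e x y|x|k x|k k0]; rewrite /distr_id.
- by case: eqP; rewrite // scaler0 addr0.
- by exists 0 => k; rewrite lt_neqAle => /andP[/negbTE ->].
- rewrite /opcomm /dz; have [-> |k0] := eqVneq k (-1).
    by rewrite /= (zmod_morphism0 (linear_zmod T_linear)) scale0r subrr.
  have -> : (k + 1 == 0) = false by lia.
  have [->|_] := eqVneq k 0; first by rewrite subrr scaler0.
  by rewrite (zmod_morphism0 (linear_zmod T_linear)) subrr scaler0.
- by have -> : (k == 0) = false by lia.
Qed.

Lemma state_field_lin e a b :
  state_field a -> state_field b -> state_field (distr_lin e a b).
Proof.
move=> [al at0 aT av] [bl bt bT bv]; split=> [k f x y|x|k x|k k0]; rewrite /distr_lin.
- by rewrite al bl !scalerDr !scalerA [e * f]mulrC addrACA.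
- have [M aM] := at0 x; have [M' bM] := bt x.
  exists (Order.min M M') => k; rewrite lt_min => /andP[kM kM'].
  by rewrite aM // bM // scaler0 addr0.
- rewrite /opcomm T_linear opprD addrACA -scalerBr.
  have := aT k x; have := bT k x; rewrite /opcomm => -> ->.
  by rewrite /dz scalerDr !scalerA mulrC.
- by rewrite av // bv // scaler0 addr0.
Qed.

Lemma state_field_dz a : state_field a -> state_field (dz a).
Proof.
move=> [al at0 aT av]; split=> [k e x y|x|k x|k k0]; rewrite /dz.
- by rewrite al scalerDr !scalerA mulrC.
- have [M aM] := at0 x; exists (M - 1) => k kM.
  by rewrite aM ?scaler0 //; lia.
- rewrite /opcomm (linear_scale _ _ T_linear) -scalerBr.
  by have := aT (k + 1) x; rewrite /opcomm => ->.
- have [->|k1] := eqVneq k (-1); first by rewrite scale0r.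
  by rewrite av ?scaler0 //; lia.
Qed.

(** Differentiating n times moves the coefficient of z^n to z^0, so that b_n v, and not only b_0 v,
    is the value of a normally ordered product up to the factor n!. *)
Lemma iter_dz a n x : iter n (@dz K V) a 0 x = n`!%:R *: a n%:Z x.
Proof.
elim: n a => [|n IH] a; first by rewrite scale1r.
by rewrite iterSr IH /dz scalerA factS natrM mulrC -addn1.
Qed.

Lemma state_field_iter_dz a n : state_field a -> state_field (iter n (@dz K V) a).
Proof. by move=> af; elim: n => //= n; apply: state_field_dz. Qed.

(** Multiplication by z - w commutes with d/dz up to the identity, so a derivative costs one extra
    factor. *)
Lemma iter_delta_dz (F : int -> int -> V) N : iter N (@delta V) F = 0 ->
  iter N.+1 (@delta V) (fun m n => (m + 1)%:~R *: F (m + 1) n) = 0.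
Proof.
have dB := @delta_morph V; have iB M := iter_zmod_morphism M dB.
elim: N F => [|N IH] F F0.
  have -> : (fun m n => (m + 1)%:~R *: F (m + 1) n) = 0.
    by apply: eq_fun2 => m n; have -> : F = 0 by []; rewrite scaler0.
  exact: zmod_morphism0 (iB 1%N).
rewrite iterSr.
have -> : delta (fun m n => (m + 1)%:~R *: F (m + 1) n) =
    (fun m n => (m + 1)%:~R *: delta F (m + 1) n) - F.
  apply: eq_fun2 => m n; have e1 : m - 1 + 1 = m by lia.
  have e2 : m + 1 - 1 = m by lia.
  rewrite fun2B /delta e1 e2 scalerBr.
  rewrite [RHS]addrAC; congr (_ - _).
  by rewrite intrD scalerDl scale1r addrK.
by rewrite iB IH ?F0 ?subr0 // -iterSr.
Qed.

Lemma local_dz a c : state_field c -> mutually_local a c -> mutually_local (dz a) c.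
Proof.
move=> [cl _ _ _] [N ac]; exists N.+1 => x.
have -> : (fun m n => opcomm (dz a m) (c n) x) =
    (fun m n => (m + 1)%:~R *: (fun m n => opcomm (a m) (c n) x) (m + 1) n).
  by apply: eq_fun2 => m n; rewrite /opcomm /dz (linear_scale _ _ (cl n)) scalerBr.
exact: (iter_delta_dz (F := fun m n => opcomm (a m) (c n) x)).
Qed.

Lemma local_iter_dz n a c : state_field c -> mutually_local a c ->
  mutually_local (iter n (@dz K V) a) c.
Proof. by move=> cf ac; elim: n => //= n; apply: local_dz. Qed.

Lemma local_id c : state_field c -> mutually_local distr_id c.
Proof.
move=> cf; exists 0%N => x; apply: eq_fun2 => m n /=.
rewrite /opcomm /distr_id; case: eqP => _; first exact: subrr.
by rewrite (zmod_morphism0 (sf_additive cf n)) subrr.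
Qed.

Lemma local_lin e a b c : state_field c ->
  mutually_local a c -> mutually_local b c -> mutually_local (distr_lin e a b) c.
Proof.
move=> [cl _ _ _] [N ac] [M bc]; exists (maxn N M) => x.
have -> : (fun m n => opcomm (distr_lin e a b m) (c n) x) =
    (fun m n => e *: opcomm (a m) (c n) x) + (fun m n => opcomm (b m) (c n) x).
  apply: eq_fun2 => m n; rewrite fun2D /opcomm /distr_lin cl.
  by rewrite scalerBr opprD addrACA.
have dB := @delta_morph V.
rewrite (zmod_morphismD (iter_zmod_morphism _ dB)).
rewrite (@iter_delta_morph _ _ ( *:%R e)); last exact: scalerBr.
rewrite (iter_eq0 dB (ac x) (leq_maxl _ _)) (iter_eq0 dB (bc x) (leq_maxr _ _)).
by apply: eq_fun2 => m n; rewrite fun2D scaler0 addr0.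
Qed.

Lemma translation_comp a b j k x : state_field a -> state_field b ->
  T (a j (b k x)) - a j (b k (T x)) =
  (j + 1)%:~R *: a (j + 1) (b k x) + (k + 1)%:~R *: a j (b (k + 1) x).
Proof.
move=> af bf; rewrite -(linear_scale _ _ (sf_linear af j)).
transitivity (opcomm T (a j) (b k x) + a j (opcomm T (b k) x)); last first.
  by rewrite (sf_translation af) (sf_translation bf).
by rewrite /opcomm (linear_zmod (sf_linear af j)) subrKA.
Qed.

Lemma iter_mul_zw a b N m n x :
  iter N (@mul_zw K V) (distr_comm a b) m n x =
  iter N (@delta V) (fun m n => opcomm (a m) (b n) x) m n.
Proof.
suff -> : iter N (@mul_zw K V) (distr_comm a b) =
  fun m n x => iter N (@delta V) (fun m n => opcomm (a m) (b n) x) m n by [].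
by elim: N => //= N ->.
Qed.

(** * The normally ordered product of two state fields *)

Section NormalProduct.
Variables a b : distr V.
Hypotheses (af : state_field a) (bf : state_field b).
Let aB := sf_additive af.
Let bB := sf_additive bf.
Let at0 := sf_truncated af.
Let bt := sf_truncated bf.

Let term m x (j : nat) := b j%:Z (a (m - j%:Z) x) + a (m + j%:Z + 1) (b (- j%:Z - 1) x).

Let term_ev0 m x : ev0 (term m x).
Proof. by apply: ev0D; [exact: (wsum_ev0l at0) | exact: (wsum_ev0r aB)]. Qed.

Lemma nprod_linear m : linear (nprod b a m).
Proof.
move=> e x y; have sB : zmod_morphism ( *:%R e : V -> V) by exact: scalerBr.
transitivity (fsum (fun j => e *: term m x j + term m y j)).
  congr fsum; apply: funext => j; rewrite /term (sf_linear af) (sf_linear bf).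
  by rewrite (sf_linear bf) (sf_linear af) scalerDr addrACA.
rewrite fsumD //; last by apply: (ev0_morph (term_ev0 m x)); rewrite scaler0.
by rewrite -fsum_morph.
Qed.

Lemma nprod_truncated : truncated (nprod b a).
Proof.
move=> x; have [N bN] := ev0_neg (-1) x bt; have [M aM] := at0 x.
(* Only the finitely many vectors b_(-j-1) x with j < N can be nonzero, so one bound serves them
   all. Below, m < M' - N keeps the indices m + j + 1 under it. *)
have [M' aM'] : exists M' : int, forall j : nat, (j < N)%N -> forall k, k < M' ->
    a k (b (- j%:Z - 1) x) = 0.
  elim: (N) => [|n [M1 aM1]]; first by exists 0.
  have [M2 aM2] := at0 (b (- n%:Z - 1) x).
  exists (Order.min M1 M2) => j; rewrite ltnS leq_eqVlt => jn k.
  rewrite lt_min => /andP[k1 k2]; case/orP: jn => [/eqP->|jn]; first exact: aM2.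
  exact: aM1.
exists (Order.min M (M' - N%:Z)) => m; rewrite lt_min => /andP[mM mM'].
apply: fsum0 => j; rewrite aM ?(zmod_morphism0 (bB _)) ?add0r; last lia.
have [jN|jN] := ltnP j N; first by rewrite aM' //; lia.
by rewrite [- _ - 1]addrC bN // (zmod_morphism0 (aB _)).
Qed.

Lemma nprod_creation m : m < 0 -> nprod b a m vac = 0.
Proof.
move=> m0; apply: fsum0 => j; rewrite (sf_creation af) ?(sf_creation bf); try lia.
by rewrite (zmod_morphism0 (bB _)) (zmod_morphism0 (aB _)) addr0.
Qed.

Lemma nprod0_vac : nprod b a 0 vac = b 0 (a 0 vac).
Proof.
rewrite /nprod /wsum (@fsumE _ _ 1%N) => [|[//|j] _].
  rewrite big_ord1 subr0 (sf_creation bf) // (zmod_morphism0 (aB _)).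
  by rewrite addr0.
rewrite (sf_creation af) ?(sf_creation bf); try lia.
by rewrite (zmod_morphism0 (bB _)) (zmod_morphism0 (aB _)) addr0.
Qed.

Lemma nprod_translation m x : opcomm T (nprod b a m) x = dz (nprod b a) m x.
Proof.
have TB := linear_zmod T_linear.
(* Termwise, [T, -] differs from d/dz by the telescoping R (j + 1) - R j. *)
rewrite /opcomm {1 2}/nprod /wsum (fsum_morph TB (term_ev0 m x)).
rewrite -(@fsumB _ (fun j => T (term m x j)) (term m (T x))) //; last first.
  by apply: (ev0_morph (term_ev0 m x)); apply: zmod_morphism0.
pose R j := j%:~R *: (b j (a (m + 1 - j) x) + a (m + 1 + j) (b (- j) x)).
have tR (j : nat) : T (term m x j) - term m (T x) j =
    (m + 1)%:~R *: term (m + 1) x j + (R j.+1%:Z - R j%:Z).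
  rewrite /R /term (zmod_morphismD TB) opprD addrACA.
  rewrite (translation_comp j%:Z (m - j%:Z) x bf af).
  rewrite (translation_comp (m + j%:Z + 1) (- j%:Z - 1) x af bf).
  have -> : m - j%:Z + 1 = m + 1 - j%:Z by lia.
  have -> : m + 1 - j.+1%:Z = m - j%:Z by lia.
  have -> : m + 1 + j.+1%:Z = m + 1 + j%:Z + 1 by lia.
  have -> : m + j%:Z + 1 = m + 1 + j%:Z by lia.
  have -> : - j.+1%:Z = - j%:Z - 1 by lia.
  have -> : - j%:Z - 1 + 1 = - j%:Z by lia.
  have -> : j%:Z + 1 = j.+1%:Z by lia.
  have -> : (m + 1 + j%:Z + 1)%:~R = (m + 1)%:~R + j.+1%:~R :> K.
    by rewrite -intrD; congr (_%:~R); lia.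
  rewrite (intrB _ (m + 1)) mulrNz !scalerDl scaleNr !scalerDr scaleNr opprD.
  by rewrite [LHS](AC ((1*2)*(2*1)) ((2*4)*((1*5)*(3*6)))).
have Re : ev0 (fun j : nat => R j%:Z).
  have [N1 a1] := ev0_neg (m + 1) x at0; have [N2 b2] := ev0_neg 0 x bt.
  exists (maxn N1 N2) => j; rewrite geq_max => /andP[j1 j2].
  have bj : b (- j%:Z) x = 0 by rewrite -sub0r b2.
  by rewrite /R a1 // bj (zmod_morphism0 (aB _)) (zmod_morphism0 (bB _)) addr0 scaler0.
transitivity (fsum (fun j => (m + 1)%:~R *: term (m + 1) x j + (R j.+1%:Z - R j%:Z))).
  by congr fsum; apply: funext => j; apply: tR.
rewrite fsumD.
- rewrite fsumB ?(fsumS Re); [|exact: (ev0_shift Re)|exact: Re].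
  (* What remains of the telescoping sum is [R 0] up to sign, and it carries the scalar 0. *)
  rewrite [R 0%:Z]scale0r add0r subrr addr0 -(fsum_morph (h := *:%R _)) //.
  exact: scalerBr.
- by apply: (ev0_morph (term_ev0 _ _)); rewrite scaler0.
- by apply: ev0D; [exact: (ev0_shift Re) | apply: (ev0_morph Re); rewrite oppr0].
Qed.

Lemma state_field_nprod : state_field (nprod b a).
Proof.
split; [exact: nprod_linear | exact: nprod_truncated
  | exact: nprod_translation | exact: nprod_creation].
Qed.
End NormalProduct.

(** * Uniqueness and existence of the state-field correspondence *)

Section Reconstruction.
Variable S : distr V -> Prop.
Hypothesis S_field : forall a, S a -> state_field a.
Hypothesis S_local : forall a b, S a -> S b -> mutually_local a b.
Hypothesis S_span : forall P : V -> Prop, P vac ->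
  (forall e x y, P x -> P y -> P (e *: x + y)) ->
  (forall a (k : nat) x, S a -> P x -> P (a k%:Z x)) -> forall x, P x.

(** On the vacuum, translation covariance becomes the recursion T a_k vac = (k + 1) a_(k+1) vac, and
    k + 1 is invertible in characteristic zero for k >= 0. *)
Lemma vacuum_coef0 a : state_field a -> a 0 vac = 0 -> forall k, a k vac = 0.
Proof.
move=> af a0; case=> [k|k]; last by rewrite (sf_creation af).
elim: k => // k IH; have := sf_translation af k%:Z vac.
have TB := linear_zmod T_linear.
rewrite /opcomm T_vac IH (zmod_morphism0 TB) (zmod_morphism0 (sf_additive af _)) subrr.
rewrite /dz => /esym/eqP; rewrite scaler_eq0 intr_eq0 => /orP[/eqP|/eqP]; last first.
  by have -> : k.+1%:Z = k%:Z + 1 by lia.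
by move=> k0; exfalso; lia.
Qed.

(* Goddard's uniqueness theorem. *)
Lemma state_field_eq a b : state_field a -> state_field b ->
  (forall c, S c -> mutually_local a c) -> (forall c, S c -> mutually_local b c) ->
  a 0 vac = b 0 vac -> a = b.
Proof.
move=> af bf aS bS ab0; pose d := distr_lin (-1) b a.
have df : state_field d by apply: state_field_lin.
have dS c : S c -> mutually_local d c.
  by move=> Sc; apply: local_lin; [apply: S_field | apply: bS | apply: aS].
suff d0 x k : d k x = 0.
  apply: eq_fun2 => k x; have /eqP := d0 x k.
  by rewrite /d /distr_lin scaleN1r addrC subr_eq0 => /eqP.
move: x k; apply: S_span => [k|e x y dx dy k|c n x Sc dx k].
- by apply: vacuum_coef0 => //; rewrite /d /distr_lin scaleN1r ab0 addNr.
- by rewrite (sf_linear df) dx dy scaler0 addr0.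
have [N dc] := dS _ Sc; have cB := sf_additive (S_field Sc).
have [M cM] := sf_truncated (S_field Sc) x.
(* As d kills x, the commutator reduces to d_m c_n x. On an antidiagonal a large m forces a small n,
   where c_n x = 0, so [iter_delta_trunc] applies. *)
have F0 : iter N (@delta V) (fun m n => d m (c n x)) = 0.
  rewrite -(dc x); congr (iter _ _ _); apply: eq_fun2 => m i.
  by rewrite /opcomm dx (zmod_morphism0 (cB _)) subr0.
have := iter_delta_trunc (s := k + n%:Z) (k := k + n%:Z - M) F0 _ k.
have -> : k + n%:Z - k = n%:Z by lia.
apply=> m km; rewrite cM ?(zmod_morphism0 (sf_additive df _)) //; lia.
Qed.

(** The second class C rides along in the induction, so that Dong's lemma is applied only here. It
    is S itself when Y is built, and the single field Y v when the values of Y are shown to be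
    pairwise local. *)
Lemma state_field_exists (C : distr V -> Prop) :
  (forall c, C c -> state_field c) -> (forall a c, S a -> C c -> mutually_local a c) ->
  forall v, exists a, [/\ state_field a, forall c, S c -> mutually_local a c,
    forall c, C c -> mutually_local a c & a 0 vac = v].
Proof.
move=> C_field C_local; apply: S_span => [|e x y [a [af aS aC <-]] [b [bf bS bC <-]]|].
- exists distr_id; split=> [|c Sc|c Cc|] //; first exact: state_field_id.
    exact/local_id/S_field.
  exact/local_id/C_field.
- exists (distr_lin e a b); split=> // [|c Sc|c Cc]; first exact: state_field_lin.
    by apply: local_lin; [apply: S_field | apply: aS | apply: bS].
  by apply: local_lin; [apply: C_field | apply: aC | apply: bC].
move=> b k x Sb [a [af aS aC <-]].
pose bk := iter k (@dz K V) b.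
have bkf : state_field bk by apply/state_field_iter_dz/S_field.
have bka : mutually_local bk a by apply/local_iter_dz/local_sym/aS.
pose p := nprod bk a.
have pf : state_field p by apply: state_field_nprod.
have pS c : S c -> mutually_local p c.
  move=> Sc; apply: local_nprod; try exact: sf_additive; try exact: sf_truncated.
  - exact/sf_additive/S_field.
  - exact: bka.
  - by apply: local_iter_dz; [apply: S_field | apply: S_local].
  - exact: aS.
have pC c : C c -> mutually_local p c.
  move=> Cc; apply: local_nprod; try exact: sf_additive; try exact: sf_truncated.
  - exact/sf_additive/C_field.
  - exact: bka.
  - by apply: local_iter_dz; [apply: C_field | apply: C_local].
  - exact: aC.
(* This is p / k!, as distr_lin e p p is (e + 1) p. *)
exists (distr_lin (k`!%:R^-1 - 1) p p); split.
- exact: state_field_lin.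
- by move=> c Sc; apply: local_lin; [exact: S_field | exact: pS | exact: pS].
- by move=> c Cc; apply: local_lin; [exact: C_field | exact: pC | exact: pC].
rewrite /distr_lin scalerBl scale1r subrK /p nprod0_vac // /bk iter_dz scalerA.
by rewrite mulVf ?scale1r // pnatr_eq0 -lt0n fact_gt0.
Qed.

Theorem reconstruction : exists! Y : V -> distr V,
  is_vertex_algebra vac T Y /\ forall a, S a -> Y (a 0 vac) = a.
Proof.
have [Y Yp] := choice (state_field_exists S_field S_local).
have Yeq v a : state_field a -> (forall c, S c -> mutually_local a c) ->
    a 0 vac = v -> Y v = a.
  move=> af aS av; have [Yf YS _ Yv] := Yp v.
  by apply: state_field_eq; rewrite ?Yv.
have YE a : S a -> Y (a 0 vac) = a.
  by move=> Sa; apply: Yeq => //; [apply: S_field | move=> c; apply: S_local].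
exists Y; split; first split=> //; first split.
- exact: T_linear.
- move=> k x e u v; have [uf uS _ u0] := Yp u; have [vf vS _ v0] := Yp v.
  rewrite (Yeq _ (distr_lin e (Y u) (Y v))) //; first exact: state_field_lin.
    by move=> c Sc; apply: local_lin; [apply: S_field | apply: uS | apply: vS].
  by rewrite /distr_lin u0 v0.
- by move=> v k; have [vf _ _ _] := Yp v; apply: sf_linear.
- by move=> v x; have [vf _ _ _] := Yp v; apply: sf_truncated.
- move=> k x; rewrite (Yeq vac distr_id) //; first exact: state_field_id.
  by move=> c Sc; apply/local_id/S_field.
- by move=> v; have [vf _ _ v0] := Yp v; split=> // k k0; apply: sf_creation.
- exact: T_vac.
- by move=> v k x; have [vf _ _ _] := Yp v; apply: sf_translation.
- move=> v w; have [vf vS _ _] := Yp v.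
  (* A field with value w is built local with Y v as well as with S; by uniqueness it is Y w. *)
  have [c cv|b c Sb cv|a [af aS aC a0]] :=
    @state_field_exists (fun c => c = Y v) _ _ w; rewrite ?cv //.
    exact/local_sym/vS.
  have [N vw] : mutually_local (Y v) (Y w).
    by rewrite (Yeq w a) //; apply/local_sym/aC.
  by exists N => m n x; rewrite iter_mul_zw vw.
(* The members of S are values of any competitor Y', so its locality axiom makes every Y' v local
   with S and uniqueness applies. *)
move=> Y' [[_ YL YE' Yt Yvac Yc _ YT Yloc] YS]; apply: funext => v; apply: Yeq.
- by split=> [k|x|k x|k k0]; [apply: YE' | apply: Yt | apply: YT | apply: (Yc v).2].
- move=> c Sc; rewrite -(YS c Sc); have [N YN] := Yloc v (c 0 vac).
  by exists N => x; apply: eq_fun2 => m n; rewrite -iter_mul_zw.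
- exact: (Yc v).1.
Qed.
End Reconstruction.
End StateFields.

(** * Derivations of the extended current algebra *)

Record derivation (K S : comPzRingType) (eta : {rmorphism K -> S}) := Derivation {
  der :> S -> S;
  derB : zmod_morphism der;
  derM : forall f g, der (f * g) = der f * g + f * der g;
  der_const : forall c, der (eta c) = 0
}.

Section LieDerivative.
Variables (K S : comPzRingType) (eta : {rmorphism K -> S}) (D : derivation eta).

Lemma der1 : D 1 = 0.
Proof. by rewrite -(rmorph1 eta) der_const. Qed.

Lemma derD f h : D (f + h) = D f + D h.
Proof. exact: (zmod_morphismD (@derB _ _ _ D)). Qed.

(* The Lie derivative w |-> L_D w is not S-linear, but (w, L_D w) is, for the
   twisted action f (w, w') = (f w, f w' + D(f) w). *)
Definition kjet : Type := (kaehler eta * kaehler eta)%type.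
HB.instance Definition _ := GRing.Zmodule.on kjet.

Let jscale (f : S) (x : kjet) : kjet := (f *: x.1, f *: x.2 + D f *: x.1).

Fact kjet_scaleA f h x : jscale f (jscale h x) = jscale (f * h) x.
Proof.
rewrite /jscale /= scalerA derM scalerDl scalerDr !scalerA; congr pair.
by rewrite -addrA; congr (_ + _); rewrite addrC.
Qed.
Fact kjet_scale1 : left_id 1 jscale.
Proof. by case=> w w'; rewrite /jscale /= der1 !scale1r scale0r addr0. Qed.
Fact kjet_scaleDr : right_distributive jscale +%R.
Proof. by move=> f x y; rewrite /jscale /= !scalerDr addrACA. Qed.
Fact kjet_scaleDl x : {morph jscale^~ x : f h / f + h}.
Proof. by move=> f h; rewrite /jscale derD !scalerDl addrACA. Qed.
HB.instance Definition _ := GRing.Zmodule_isLmodule.Build S kjet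
  kjet_scaleA kjet_scale1 kjet_scaleDr kjet_scaleDl.

Definition kjet_lift : kaehler eta -> kjet :=
  mlift (flift (fun h => (kd eta h, kd eta (D h)) : kjet)).

Definition lie_der (w : kaehler eta) : kaehler eta := (kjet_lift w).2.

Fact kjet_rel s : kaehler_rel eta s ->
  flift (fun h => (kd eta h, kd eta (D h)) : kjet) s = 0.
Proof.
have d0 : kd eta 0 = 0 by rewrite -(rmorph0 eta) kd_const.
case=> [c|f h|f h].
- by rewrite flift_fbasis der_const kd_const d0.
- rewrite linearB linearD /= !flift_fbasis derD !kdD; exact: subrr.
- rewrite linearB linearD !linearZ /= !flift_fbasis; apply/eqP.
  rewrite subr_eq0; apply/eqP; congr pair; rewrite /= ?kdM // derM kdD !kdM.
  by rewrite [RHS](AC (2*2) ((2*3)*(1*4))).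
Qed.

Lemma kjet_lift_linear : linear kjet_lift.
Proof. exact: mlift_linear kjet_rel. Qed.

Lemma kjet_lift_d h : kjet_lift (kd eta h) = (kd eta h, kd eta (D h)).
Proof. by rewrite /kjet_lift [LHS](mlift_cls _ kjet_rel) /= flift_fbasis. Qed.

(** Identifies the differential in the twisted term of the module action, from which the Leibniz
    rule [lie_derZ] follows. *)
Lemma kjet_lift1 w : (kjet_lift w).1 = w.
Proof.
elim/kaehler_ind: w => [|f h w IH].
  by rewrite (zmod_morphism0 (linear_zmod kjet_lift_linear)).
by rewrite kjet_lift_linear kjet_lift_d /= IH.
Qed.

Lemma lie_derB : zmod_morphism lie_der.
Proof. by move=> u v; rewrite /lie_der (linear_zmod kjet_lift_linear). Qed.

Lemma lie_derZ f w : lie_der (f *: w) = f *: lie_der w + D f *: w.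
Proof.
by rewrite /lie_der (linear_scale _ _ kjet_lift_linear) /= kjet_lift1.
Qed.

Lemma lie_der_d h : lie_der (kd eta h) = kd eta (D h).
Proof. by rewrite /lie_der kjet_lift_d. Qed.

(** The Lie derivative descends to the quotient because it sends dh to the exact form d(D h). *)
Definition kaehlerH_der : kaehlerH eta -> kaehlerH eta :=
  @mlift K (kaehlerK eta) (@kaehler_exact K S eta) _ (fun w => kcls (lie_der w)).

Let lie_der_linearK : linear (fun w : kaehlerK eta => kcls (lie_der w)).
Proof.
move=> c u v; rewrite -kclsZ -kclsD; congr kcls.
rewrite (zmod_morphismD lie_derB); congr (_ + _).
by rewrite [LHS](lie_derZ (eta c) u) der_const scale0r addr0.
Qed.

Let lie_der_exact s : kaehler_exact (eta := eta) s -> kcls (lie_der s) = 0.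
Proof. by move=> [h ->]; rewrite lie_der_d kcls_exact. Qed.

Lemma kaehlerH_der_cls w : kaehlerH_der (kcls w) = kcls (lie_der w).
Proof.
pose f : {linear kaehlerK eta -> kaehlerH eta} :=
  HB.pack (fun w : kaehlerK eta => kcls (lie_der w))
    (GRing.isLinear.Build _ _ _ _ _ lie_der_linearK).
exact: (mlift_cls (f := f)).
Qed.

Lemma kaehlerH_der_linear : linear kaehlerH_der.
Proof.
pose f : {linear kaehlerK eta -> kaehlerH eta} :=
  HB.pack (fun w : kaehlerK eta => kcls (lie_der w))
    (GRing.isLinear.Build _ _ _ _ _ lie_der_linearK).
exact: (mlift_linear (f := f)).
Qed.
End LieDerivative.

Section GhatDerivation.
Variables (K : numFieldType) (g : lieAlgType K) (B : invariant_form g).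
Variables (S : comPzRingType) (eta : {rmorphism K -> S}) (D : derivation eta).
Local Notation SK := (restr eta S^o).

Definition cur_der : tensor g SK -> tensor g SK :=
  tlift (fun J (r : SK) => tens J (D r : SK)).

Let cur_der_bilin : bilin (fun (J : g) (r : SK) => tens J (D r : SK)).
Proof.
split=> [r c u v|J c u v]; first exact: tens_linl.
rewrite -tens_linr; congr tens; apply: etrans (derD D _ _) _; congr (_ + _).
by apply: etrans (derM D (eta c) u) _; rewrite der_const mul0r add0r.
Qed.

Lemma cur_der_tens J (r : S) : cur_der (tens J (r : SK)) = tens J (D r : SK).
Proof. exact: tliftE. Qed.

Lemma cur_der_linear : linear cur_der.
Proof. exact: tlift_linear. Qed.

Definition ghat_der (x : ghat B eta) : ghat B eta := (cur_der x.1, kaehlerH_der D x.2).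

Lemma ghat_der_linear : linear ghat_der.
Proof.
by move=> c x y; rewrite /ghat_der /= cur_der_linear kaehlerH_der_linear.
Qed.

Lemma tensD (J : g) (r s : SK) : tens J (r + s) = tens J r + tens J s.
Proof. by have := tens_linr 1 J r s; rewrite !scale1r. Qed.

(** Both sides are biadditive in the current parts, which reduces to pure tensors. There the central
    component is L_D(r ds) = D(r) ds + r d(D s). *)
Lemma ghat_der_lie x y : ghat_der (lie x y) = lie (ghat_der x) y + lie x (ghat_der y).
Proof.
have CD := zmod_morphismD (linear_zmod cur_der_linear).
have HD := zmod_morphismD (linear_zmod (kaehlerH_der_linear D)).
have lD y' := zmod_morphismD (linear_zmod (cur_lie_linearl (eta := eta) y' (g := g))).
have rD x' := zmod_morphismD (linear_zmod (cur_lie_linearr (eta := eta) x' (g := g))).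
have clD y' := zmod_morphismD (linear_zmod (cocycle_linearl B (eta := eta) y')).
have crD x' := zmod_morphismD (linear_zmod (cocycle_linearr B (eta := eta) x')).
case: x y => [x x'] [y y']; congr pair; rewrite {x' y'}/=.
  apply: (@tensor_eq2 _ _ _ _ (fun x y => cur_der (cur_lie x y))
    (fun x y => cur_lie (cur_der x) y + cur_lie x (cur_der y))).
  - by move=> z u v; rewrite lD CD.
  - by move=> z u v; rewrite rD CD.
  - by move=> z u v; rewrite CD (lD z) (lD (cur_der z)); apply: addrACA.
  - by move=> z u v; rewrite CD (rD z) (rD (cur_der z)); apply: addrACA.
  - move=> J r J' s; rewrite !cur_der_tens !cur_lieE -tensD cur_der_tens.
    by congr tens; exact: (derM D r s).
apply: (@tensor_eq2 _ _ _ _ (fun x y => kaehlerH_der D (cocycle B x y))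
  (fun x y => cocycle B (cur_der x) y + cocycle B x (cur_der y))).
- by move=> z u v; rewrite clD HD.
- by move=> z u v; rewrite crD HD.
- by move=> z u v; rewrite CD (clD z) (clD (cur_der z)); apply: addrACA.
- by move=> z u v; rewrite CD (crD z) (crD (cur_der z)); apply: addrACA.
move=> J r J' s; rewrite !cur_der_tens !cocycleE.
rewrite (linear_scale _ _ (kaehlerH_der_linear D)) kaehlerH_der_cls lie_derZ.
by rewrite lie_der_d kclsD addrC scalerDr.
Qed.
End GhatDerivation.

Section GhatMapDerivation.
Variables (K : numFieldType) (g : lieAlgType K) (B : invariant_form g).
Variables (S S' : comPzRingType).
Variables (eta : {rmorphism K -> S}) (eta' : {rmorphism K -> S'}).
Variables (D : derivation eta) (D' : derivation eta') (phi : {rmorphism S -> S'}).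
Hypothesis phi_eta : forall c, phi (eta c) = eta' c.
Hypothesis phi_der : forall f, phi (D f) = D' (phi f).

Lemma kaehler_map_der w :
  kaehler_map eta' phi (lie_der D w) = lie_der D' (kaehler_map eta' phi w).
Proof.
have mD := kaehler_mapD (eta := eta) phi_eta.
have m0 : kaehler_map (eta := eta) eta' phi 0 = 0.
  by apply: (addIr (kaehler_map (eta := eta) eta' phi 0)); rewrite -mD !add0r.
elim/kaehler_ind: w => [|f h w IH].
  by rewrite (zmod_morphism0 (lie_derB D)) m0 (zmod_morphism0 (lie_derB D')).
rewrite mD !(zmod_morphismD (lie_derB _)) mD {}IH; congr (_ + _).
rewrite kaehler_map_d // !lie_derZ !lie_der_d mD !kaehler_map_d // !phi_der.
by [].
Qed.

(** For the inclusion of A[t] into R this says that -d/dt preserves the subalgebra from which the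
    module is induced. *)
Lemma ghat_map_der (x : ghat B eta) :
  ghat_map eta' phi (ghat_der D x) = ghat_der D' (ghat_map eta' phi x).
Proof.
case: x => x y; congr pair; rewrite /=.
  have CD := zmod_morphismD (linear_zmod (cur_map_linear (g := g) phi_eta)).
  have DD := zmod_morphismD (linear_zmod (cur_der_linear (g := g) D)).
  have DD' := zmod_morphismD (linear_zmod (cur_der_linear (g := g) D')).
  elim/tensor_ind: x => [|J r x IH].
    rewrite !(zmod_morphism0 (linear_zmod (cur_der_linear _))).
    by rewrite !(zmod_morphism0 (linear_zmod (cur_map_linear phi_eta)))
      (zmod_morphism0 (linear_zmod (cur_der_linear _))).
  rewrite DD !CD DD' IH; congr (_ + _).
  by rewrite !(cur_der_tens, cur_map_tens) // phi_der.
elim/mquot_ind: y => w.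
rewrite [X in kaehlerH_map _ _ X](kaehlerH_der_cls D w) !kaehlerH_map_cls //.
by rewrite kaehlerH_der_cls kaehler_map_der.
Qed.
End GhatMapDerivation.

(** * Derivations of the induced module *)

Section UenvGenerators.
Variables (K : comPzRingType) (L : lieAlgType K).
Local Notation F := (monalg K (@cat L : Monoid.law [::])).
Local Notation δ w := (@fbasis K (seq L) w : F).

Lemma ucls_word w : ucls (δ w) = \prod_(x <- w) uinj x :> uenv L.
Proof.
elim: w => [|x w IH]; first by rewrite big_nil -ucls1.
by rewrite big_cons -IH /uinj -uclsM monalg_basisM.
Qed.

Lemma uenv_gen_ind (P : uenv L -> Prop) : P 1 ->
  (forall x u, P u -> P (uinj x * u)) ->
  (forall c u v, P u -> P v -> P (c *: u + v)) -> forall u, P u.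
Proof.
move=> P1 PM PD; elim/uenv_ind; elim/freemod_ind=> [|c w f IH].
  have -> : ucls 0 = (-1) *: (1 : uenv L) + 1; last exact: PD.
  by rewrite scaleN1r addNr; apply: (linear0 (mcls _)).
have -> : ucls (c *: δ w + f) = c *: ucls (δ w) + ucls f by rewrite uclsD uclsZ.
apply: PD => //; rewrite ucls_word; elim: w => [|x w IHw]; first by rewrite big_nil.
by rewrite big_cons; apply: PM.
Qed.

Lemma uaug_linear : linear (@uaug K L : _ -> K^o).
Proof.
apply: mlift_linear => s; apply: (@uenv_lift_ideal K L K^o (fun x y => (x : K) * y)).
- split=> [z c x y|z c x y].
    by apply: etrans (mulrDl _ _ _) _; congr (_ + _); apply/esym/mulrA.
  by apply: etrans (mulrDr _ _ _) _; congr (_ + _); apply: mulrCA.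
- by case=> [|x w] [|y w']; rewrite ?mulr0 ?mul0r ?mulr1.
- by move=> c x y; rewrite scaler0 addr0.
- by move=> x y; rewrite mulr0 subrr.
Qed.

Lemma uaug_gen x (u : uenv L) : uaug (uinj x * u) = 0.
Proof.
elim/uenv_ind: u => f; rewrite /uinj -uclsM uaug_cls.
elim/freemod_ind: f => [|c w f IH]; first by rewrite mulr0 linear0.
rewrite mulrDr -[X in X + _]monalg_scaleAr monalg_basisM linearP /= flift_fbasis.
by rewrite IH scaler0 addr0.
Qed.

End UenvGenerators.

Lemma uenv_map_linear (K : comPzRingType) (L L' : lieAlgType K) (h : L -> L') :
  linear h -> (forall x y, h (lie x y) = lie (h x) (h y)) -> linear (uenv_map h).
Proof.
move=> h_linear h_lie; apply: mlift_linear => s.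
apply: (uenv_lift_ideal (uenv_bilin L')) => [x y|c x y|x y].
- by rewrite big_cat.
- by rewrite !big_seq1 h_linear uinj_linear.
- by rewrite !big_seq1 h_lie uinj_lie.
Qed.

(** * Extension of a Lie algebra derivation to the enveloping algebra *)

Section UenvDerivation.
Variables (K : comPzRingType) (L : lieAlgType K) (D : L -> L).
Hypothesis D_linear : linear D.
Hypothesis D_lie : forall x y, D (lie x y) = lie (D x) y + lie x (D y).

(* The product of the trivial extension of U(L) by itself: u |-> (u, D u) is
   multiplicative for it exactly when D is a derivation. *)
Let pmul (p q : uenv L * uenv L) : uenv L * uenv L := (p.1 * q.1, p.2 * q.1 + p.1 * q.2).

Let pword (w : seq L) : uenv L * uenv L :=
  foldr (fun x => pmul (uinj x, uinj (D x))) (1, 0) w.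

Let lift : uenv L -> uenv L * uenv L := mlift (flift pword).

Definition uenv_der (u : uenv L) : uenv L := (lift u).2.

Let pmul_bilin : bilin pmul.
Proof.
have [bl br] := uenv_bilin L.
split=> [z c x y|z c x y]; rewrite /pmul /=.
  congr pair; first exact: bl.
  rewrite [X in X + _](bl z.1 c x.2 y.2) [X in _ + X](bl z.2 c x.1 y.1).
  by rewrite /= scalerDr addrACA.
congr pair; first exact: br.
rewrite [X in X + _](br z.2 c x.1 y.1) [X in _ + X](br z.1 c x.2 y.2).
by rewrite /= scalerDr addrACA.
Qed.

Let pwordM x y : pword (x ++ y) = pmul (pword x) (pword y).
Proof.
elim: x => [|z x IH] /=; first by rewrite /pmul /= !mul1r mul0r add0r; case: pword.
by rewrite IH /pmul /= mulrA mulrDl mulrDr !mulrA addrA.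
Qed.

Let pword1 x : pword [:: x] = (uinj x, uinj (D x)).
Proof. by rewrite /= /pmul /= !mulr1 mulr0 addr0. Qed.

Let pword_linear : linear (fun x => pword [:: x]).
Proof. by move=> c x y; rewrite !pword1 D_linear !uinj_linear. Qed.

Let pword_lie x y : pword [:: lie x y] =
  pmul (pword [:: x]) (pword [:: y]) - pmul (pword [:: y]) (pword [:: x]).
Proof.
have uD := zmod_morphismD (linear_zmod (@uinj_linear K L)).
rewrite !pword1 D_lie uD !uinj_lie /pmul; congr pair.
by rewrite /= addrACA -opprD [in RHS](addrC (uinj (D y) * _)).
Qed.

Let lift_linear : linear lift.
Proof.
apply: mlift_linear => s.
exact: (uenv_lift_ideal pmul_bilin pwordM pword_linear pword_lie).
Qed.

Let liftE f : lift (ucls f) = flift pword f.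
Proof. exact: (uenv_liftE pmul_bilin pwordM pword_linear pword_lie). Qed.

Let liftM x y : lift (x * y) =
  pmul (lift x) (lift y).
Proof.
elim/uenv_ind: x => x; elim/uenv_ind: y => y; rewrite -uclsM !liftE.
exact: (flift_monalgM (op := (@cat L : Monoid.law [::])) pmul_bilin pwordM).
Qed.

Let lift_inj x : lift (uinj x) = (uinj x, uinj (D x)).
Proof. by rewrite liftE flift_fbasis pword1. Qed.

Let lift_one : lift 1 = (1, 0).
Proof. by rewrite -ucls1 liftE -monalg_basis1 flift_fbasis. Qed.

Let lift_fst u : (lift u).1 = u.
Proof.
elim/uenv_gen_ind: u => [|x u IH|c u v IHu IHv]; first by rewrite lift_one.
  by rewrite liftM lift_inj /= IH.
transitivity (c *: (lift u).1 + (lift v).1); first by rewrite lift_linear.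
by congr (_ *: _ + _).
Qed.

Let uenv_der_linear : linear uenv_der.
Proof. by move=> c u v; rewrite /uenv_der lift_linear. Qed.

Let uenv_derM u v : uenv_der (u * v) = uenv_der u * v + u * uenv_der v.
Proof.
transitivity ((lift u).2 * (lift v).1 + (lift u).1 * (lift v).2).
  by rewrite /uenv_der liftM.
by congr (_ + _); [congr (_ * _) | congr (_ * _)]; apply: lift_fst.
Qed.

Let uenv_der_inj x : uenv_der (uinj x) = uinj (D x).
Proof. by rewrite /uenv_der lift_inj. Qed.

Lemma uenv_der_exists : exists d : uenv L -> uenv L,
  [/\ linear d, forall u v, d (u * v) = d u * v + u * d v &
      forall x, d (uinj x) = uinj (D x)].
Proof. by exists uenv_der. Qed.
End UenvDerivation.

Section DerivationOnGenerators.
Variables (K : comPzRingType) (L : lieAlgType K) (D : L -> L) (d : uenv L -> uenv L).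
Hypothesis d_linear : linear d.
Hypothesis dM : forall u v, d (u * v) = d u * v + u * d v.
Hypothesis d_inj : forall x, d (uinj x) = uinj (D x).

Lemma uenv_der1 : d 1 = 0.
Proof. by have /eqP := dM 1 1; rewrite !mul1r mulr1 -subr_eq subrr => /eqP. Qed.

(** The derivation has its image in the augmentation ideal: d 1 = 0, and d(x u) = D(x) u + x d(u) is
    a sum of products starting with a generator. *)
Lemma uenv_augmentation_der (e : uenv L -> K) : linear (e : _ -> K^o) ->
  (forall x u, e (uinj x * u) = 0) -> forall u, e (d u) = 0.
Proof.
move=> e_linear e0; have eD := zmod_morphismD (linear_zmod e_linear).
elim/uenv_gen_ind => [|x u IH|c u v IHu IHv].
- by rewrite uenv_der1; apply: (zmod_morphism0 (linear_zmod e_linear)).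
- by rewrite dM d_inj [LHS]eD !e0 addr0.
transitivity (c * e (d u) + e (d v)); first by rewrite d_linear; apply: e_linear.
by rewrite IHu IHv mulr0 addr0.
Qed.

(** Both sides are derivations along m, so agreement on the generators suffices. *)
Lemma uenv_morphism_der (L' : lieAlgType K) (h : L' -> L) (D' : L' -> L')
    (d' : uenv L' -> uenv L') (m : uenv L' -> uenv L) :
  linear d' -> (forall u v, d' (u * v) = d' u * v + u * d' v) -> d' 1 = 0 ->
  (forall x, d' (uinj x) = uinj (D' x)) -> (forall x, h (D' x) = D (h x)) ->
  linear m -> (forall u v, m (u * v) = m u * m v) -> m 1 = 1 ->
  (forall x, m (uinj x) = uinj (h x)) -> forall u, m (d' u) = d (m u).
Proof.
move=> d'_linear d'M d'1 d'_inj hD m_linear mM m1 m_inj.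
have mD := zmod_morphismD (linear_zmod m_linear).
elim/uenv_gen_ind => [|x u IH|c u v IHu IHv].
- by rewrite d'1 m1 uenv_der1 (zmod_morphism0 (linear_zmod m_linear)).
- by rewrite d'M mD !mM d'_inj !m_inj dM d_inj hD IH.
by rewrite d'_linear !m_linear d_linear IHu IHv.
Qed.
End DerivationOnGenerators.

Section LinearCombinators.
Variables (K : comPzRingType) (U V : lmodType K).

Lemma linear_fun_lin c (f f' : U -> V) :
  linear f -> linear f' -> linear (fun x => c *: f x + f' x).
Proof.
by move=> fl fl' e x y; rewrite fl fl' !scalerDr !scalerA [c * e]mulrC addrACA.
Qed.

Lemma linear_opcomm (f f' : V -> V) : linear f -> linear f' -> linear (opcomm f f').
Proof.
move=> fl fl' e x y; rewrite /opcomm fl' !fl fl' scalerBr opprD addrACA.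
by [].
Qed.
End LinearCombinators.

Section InducedModule.
Variables (K : comPzRingType) (L L' : lieAlgType K) (h : L' -> L).

Lemma indtDl u v c : indt h (u + v) c = indt h u c + indt h v c.
Proof. by have := indt_linl h 1 u v c; rewrite !scale1r. Qed.

Lemma indt0r u : indt h u 0 = 0.
Proof. by have := indt_linr h (-1) u 0 0; rewrite mulr0 addr0 scaleN1r addNr. Qed.

Lemma indt0l c : indt h 0 c = 0.
Proof. by have := indt_linl h (-1) 0 0 c; rewrite scaler0 addr0 scaleN1r addNr. Qed.

Lemma indtZ u c : indt h u c = c *: indt h u 1.
Proof. by have := indt_linr h c u 1 0; rewrite mulr1 addr0 indt0r addr0. Qed.

Lemma induced_indt_ind (P : induced h -> Prop) :
  (forall u, P (indt h u 1)) ->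
  (forall c x y, P x -> P y -> P (c *: x + y)) -> forall x, P x.
Proof.
move=> Pu PD; elim/mquot_ind; elim/freemod_ind=> [|c [u e] f IH].
  by rewrite linear0 -(indt0l 1).
have -> : mcls (ind_rel h) (c *: fbasis K (u, e) + f) =
    c *: indt h u e + mcls (ind_rel h) f by exact: linearP.
by rewrite indtZ scalerA; apply: PD.
Qed.

Lemma induced_eq (W : lmodType K) (f f' : induced h -> W) : linear f -> linear f' ->
  (forall u, f (indt h u 1) = f' (indt h u 1)) -> forall v, f v = f' v.
Proof.
move=> fl fl' ff'; elim/induced_indt_ind => // c x y fx fy.
by rewrite fl fl' fx fy.
Qed.

Lemma ind_act_linearl v : linear (fun x => @ind_act _ _ _ h x v).
Proof.
move=> c x y; move: v; apply: induced_eq => [||u].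
- exact: ind_act_linear.
- exact: (linear_fun_lin c (ind_act_linear x) (ind_act_linear y)).
by rewrite !ind_actE uinj_linear mulrDl -uenv_scaleAl indt_linl.
Qed.

Lemma ind_act_lie x y v : @ind_act _ _ _ h (lie x y) v = opcomm (ind_act x) (ind_act y) v.
Proof.
move: v; apply: induced_eq => [||u].
- exact: ind_act_linear.
- exact: (linear_opcomm (ind_act_linear x) (ind_act_linear y)).
rewrite /opcomm !ind_actE uinj_lie mulrBl -!mulrA.
have := indtDl (uinj x * (uinj y * u) - uinj y * (uinj x * u)) (uinj y * (uinj x * u)) 1.
by rewrite subrK => ->; rewrite addrK.
Qed.

Lemma induced_ind (P : induced h -> Prop) : P (ind_vac h) ->
  (forall x v, P v -> P (ind_act x v)) ->
  (forall c x y, P x -> P y -> P (c *: x + y)) -> forall v, P v.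
Proof.
move=> P1 PM PD; apply: induced_indt_ind; last exact: PD.
elim/uenv_gen_ind=> [|x u IH|c u v IHu IHv]; first exact: P1.
  by have := PM x _ IH; rewrite ind_actE.
by rewrite indt_linl; apply: PD.
Qed.
End InducedModule.

(** * Descent of a derivation to the induced module *)

Section InducedDerivation.
Variables (K : comPzRingType) (L L' : lieAlgType K) (h : L' -> L).
Hypothesis h_linear : linear h.
Hypothesis h_lie : forall x y, h (lie x y) = lie (h x) (h y).
Variables (D : L -> L) (D' : L' -> L').
Hypothesis D_linear : linear D.
Hypothesis D_lie : forall x y, D (lie x y) = lie (D x) y + lie x (D y).
Hypothesis D'_linear : linear D'.
Hypothesis D'_lie : forall x y, D' (lie x y) = lie (D' x) y + lie x (D' y).
Hypothesis hD : forall x, h (D' x) = D (h x).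

(** The operator is d tensored with the identity. It respects the balancing because d(u h(b)) = d(u)
    h(b) + u h(d' b), where the last term acts through the augmentation of d' b, which is zero. *)
Lemma ind_der_exists : exists T : induced h -> induced h,
  [/\ linear T, T (ind_vac h) = 0 & forall x v, opcomm T (ind_act x) v = ind_act (D x) v].
Proof.
have [d [d_linear dM d_inj]] := uenv_der_exists D_linear D_lie.
have [d' [d'_linear d'M d'_inj]] := uenv_der_exists D'_linear D'_lie.
have d1 := uenv_der1 dM; have d'1 := uenv_der1 d'M.
have md u : uenv_map h (d' u) = d (uenv_map h u).
  apply: (uenv_morphism_der d_linear dM d_inj d'_linear d'M d'1 d'_inj hD).
  - exact: uenv_map_linear.
  - exact: uenv_mapM.
  - by rewrite -ucls1 uenv_map_cls // -monalg_basis1 flift_fbasis big_nil.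
  - exact: uenv_map_inj.
have ad u : uaug (d' u) = 0.
  by apply: (uenv_augmentation_der d'_linear d'M d'_inj);
    [apply: uaug_linear | apply: uaug_gen].
pose phi (p : uenv L * K) := indt h (d p.1) p.2.
have phi0 s : ind_rel h s -> flift phi s = 0.
  case=> [a u v c|a u b c|u b c].
  - by rewrite linearB linearP /= !flift_fbasis /phi /= d_linear indt_linl subrr.
  - by rewrite linearB linearP /= !flift_fbasis /phi /= indt_linr subrr.
  - rewrite linearB /= !flift_fbasis /phi /= dM indtDl -md.
    by rewrite !indt_balanced ad mul0r indt0r addr0 subrr.
have TE u c : mlift (flift phi) (indt h u c) = indt h (d u) c.
  by rewrite [LHS](mlift_cls _ phi0) /= flift_fbasis.
have TL : linear (mlift (S := ind_rel h) (flift phi)) by exact: mlift_linear phi0.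
exists (mlift (flift phi)).
move: (mlift (flift phi)) TE TL => T TE TL.
split=> // [|x v]; first by rewrite TE d1 indt0l.
move: v; apply: induced_eq => [||u].
- exact: (linear_opcomm TL (ind_act_linear x)).
- exact: ind_act_linear.
by rewrite /opcomm !(ind_actE, TE) dM d_inj indtDl addrK.
Qed.
End InducedDerivation.

(** * Vertex algebras from modes of a Lie algebra *)

Section ModeAlgebra.
Variables (K : numFieldType) (L : lieAlgType K) (V : lmodType K) (vac : V).
Variables (act : L -> V -> V) (I : Type) (md : I -> int -> L).
Hypothesis act_linearl : forall v, linear (act^~ v).
Hypothesis act_linearr : forall x, linear (act x).
Hypothesis act_lie : forall x y v, act (lie x y) v = opcomm (act x) (act y) v.
Hypothesis L_span : forall P : L -> Prop,
  (forall c x y, P x -> P y -> P (c *: x + y)) -> (forall i n, P (md i n)) ->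
  forall x, P x.
Hypothesis V_cyclic : forall P : V -> Prop, P vac ->
  (forall x v, P v -> P (act x v)) ->
  (forall c x y, P x -> P y -> P (c *: x + y)) -> forall v, P v.
Hypothesis md_vac : forall i (n : nat), act (md i n%:Z) vac = 0.
Hypothesis md_lie : forall a b, exists c1 c2 c3, exists e : K, forall m n,
  lie (md a m) (md b n) =
  md c1 (m + n) + (e *: md c2 (m + n) + (e * n%:~R) *: md c3 (m + n - 1)).

Let act0r x : act x 0 = 0.
Proof. exact: zmod_morphism0 (linear_zmod (act_linearr x)). Qed.

Let actDl x y v : act (x + y) v = act x v + act y v.
Proof. exact: (zmod_morphismD (linear_zmod (act_linearl v))). Qed.

Let actZl c x v : act (c *: x) v = c *: act x v.
Proof. exact: linear_scale (act_linearl v). Qed.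

Lemma act_swap x y v : act x (act y v) = act y (act x v) + act (lie x y) v.
Proof. by rewrite act_lie /opcomm addrC subrK. Qed.

(** T(x v) = x T(v) + [T, x] v carries the agreement from the vacuum to every vector of the cyclic
    module. *)
Lemma translation_unique (T T' : V -> V) : linear T -> linear T' ->
  T vac = T' vac ->
  (forall i n, exists w, forall v, opcomm T (act (md i n)) v = act w v /\
    opcomm T' (act (md i n)) v = act w v) -> T = T'.
Proof.
move=> Tl Tl' Tv TT; apply: funext; apply: V_cyclic => // [|c x y Tx Ty].
  move=> x v Tx; move: x; apply: L_span => [c x y Px Py|i n].
    by rewrite act_linearl Tl Tl' Px Py.
  have [w /(_ v)[]] := TT i n; rewrite /opcomm => <- /eqP.
  by rewrite Tx (can_eq (addrNK _)) eq_sym => /eqP.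
by rewrite Tl Tl' Tx Ty.
Qed.

(* A word in the modes can be rewritten with all annihilation operators on the
   right, where they kill the vacuum. *)
Lemma creation_span (P : V -> Prop) : P vac ->
  (forall c x y, P x -> P y -> P (c *: x + y)) ->
  (forall i (k : nat) x, P x -> P (act (md i (- k%:Z - 1)) x)) -> forall x, P x.
Proof.
move=> Pvac PD Pc.
(* The span of the creation words, in impredicative form. It is shown stable under each x in L by
   induction on the word: x passes the first letter y at the cost of [x, y], again an element of L,
   acting on a shorter word. *)
pose W v := forall Q : V -> Prop, Q vac -> (forall c x y, Q x -> Q y -> Q (c *: x + y)) ->
  (forall i (k : nat) x, Q x -> Q (act (md i (- k%:Z - 1)) x)) -> Q v.
suff WT v : W v by move=> v; exact: (WT v P).
have Wvac : W vac by move=> Q.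
have WD c x y : W x -> W y -> W (c *: x + y).
  by move=> Wx Wy Q Q1 QD Qc; apply: (QD); [apply: Wx | apply: Wy].
have Wc i (k : nat) x : W x -> W (act (md i (- k%:Z - 1)) x).
  by move=> Wx Q Q1 QD Qc; apply: (Qc); apply: Wx.
have W0 : W 0 by have := WD (-1) vac vac Wvac Wvac; rewrite scaleN1r addNr.
have WA u : W u -> W u /\ forall x, W (act x u).
  move=> Wu; pose Q v := W v /\ forall x, W (act x v); apply: (Wu Q).
  - split=> //; apply: L_span => [c x y Wx Wy|i [n|n]].
    + by rewrite act_linearl; apply: WD.
    + by rewrite md_vac.
    + by have := Wc i n vac Wvac; have -> : - n%:Z - 1 = Negz n by lia.
  - move=> c y w [Wy Ay] [Ww Aw]; split; first exact: WD.
    by move=> x; rewrite act_linearr; apply: WD.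
  - move=> i k y [Wy Ay]; split; first exact: Wc.
    move=> x; rewrite act_swap -[X in W (X + _)]scale1r; apply: WD => //.
    exact: Wc.
move: v; apply: V_cyclic => // x v Wv; exact: (WA v Wv).2.
Qed.

Definition mode_field (i : I) : distr V := fun k => act (md i (- k - 1)).

(** Induction on creation words, for all generators at once because the bracket with a letter b_f
    brings in [c1], [c2], [c3]. Their indices are n + f and n + f - 1, which explains the shifted
    bounds in the maximum. *)
Lemma mode_field_truncated i : truncated (mode_field i).
Proof.
suff H x : forall i, exists N : int, forall n, N <= n -> act (md i n) x = 0.
  move=> x; have [N HN] := H x i; exists (- N) => k kN.
  by rewrite /mode_field HN //; lia.
move: x; apply: creation_span => [j|c x y Hx Hy j|b k x Hx a].
- by exists 0; case=> // n _.
- have [N HN] := Hx j; have [M HM] := Hy j; exists (Order.max N M) => n.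
  by rewrite ge_max => /andP[/HN nN /HM nM]; rewrite act_linearr nN nM scaler0 addr0.
have [c1 [c2 [c3 [e ab]]]] := md_lie a b; set f := - k%:Z - 1.
have [N0 H0] := Hx a; have [N1 H1] := Hx c1; have [N2 H2] := Hx c2.
have [N3 H3] := Hx c3.
exists (Order.max N0 (Order.max (N1 - f) (Order.max (N2 - f) (N3 - f + 1)))) => n.
rewrite !ge_max => /and4P[n0 n1 n2 n3].
rewrite act_swap ab !actDl !actZl H0 // H1 ?H2 ?H3; try lia.
by rewrite act0r !scaler0 !addr0.
Qed.

(** On each antidiagonal m + n = s the commutator is an affine function of n, so two finite
    differences annihilate it. *)
Lemma mode_field_local i j : mutually_local (mode_field i) (mode_field j).
Proof.
have [c1 [c2 [c3 [e ab]]]] := md_lie i j; exists 2%N => x.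
pose X (s : int) := act (md c1 (- s - 2)) x + e *: act (md c2 (- s - 2)) x.
pose Y (s : int) := e *: act (md c3 (- s - 3)) x.
have -> : (fun m n => opcomm (mode_field i m) (mode_field j n) x) =
    (fun m n => X (m + n) + (- n - 1)%:~R *: Y (m + n)).
  apply: eq_fun2 => m n; rewrite -[LHS]act_lie ab /X /Y !actDl !actZl -[RHS]addrA.
  have -> : - m - 1 + (- n - 1) = - (m + n) - 2 by lia.
  have -> : - (m + n) - 2 - 1 = - (m + n) - 3 by lia.
  by rewrite scalerA mulrC.
have d1 : delta (fun m n => X (m + n) + (- n - 1)%:~R *: Y (m + n)) =
    (fun m n => - Y (m + n - 1)).
  apply: eq_fun2 => m n; rewrite /delta.
  have -> : m - 1 + n = m + n - 1 by lia.
  have -> : m + (n - 1) = m + n - 1 by lia.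
  rewrite opprD addrACA subrr add0r -scalerBl -intrB.
  have -> : - n - 1 - (- (n - 1) - 1) = -1 by lia.
  by rewrite (intrN K 1) scaleN1r.
rewrite /= d1; apply: eq_fun2 => m n; rewrite /delta.
have -> : m - 1 + n = m + n - 1 by lia.
have -> : m + (n - 1) = m + n - 1 by lia.
exact: subrr.
Qed.

Section Translation.
Variable T : V -> V.
Hypotheses (T_linear : linear T) (T_vac : T vac = 0).
Hypothesis T_md : forall i n x,
  opcomm T (act (md i n)) x = - n%:~R *: act (md i (n - 1)) x.

Lemma mode_field_state i : state_field vac T (mode_field i).
Proof.
split=> [k|x|k x|k k0]; rewrite /mode_field.
- exact: act_linearr.
- exact: mode_field_truncated.
- rewrite T_md /dz -intrN; have -> : - (- k - 1) = k + 1 by lia.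
  by have -> : - k - 1 - 1 = - (k + 1) - 1 by lia.
- by have -> : - k - 1 = (absz (- k - 1))%:Z by lia.
Qed.

Lemma mode_vertex_algebra : exists! Y : V -> distr V,
  is_vertex_algebra vac T Y /\
  forall i k, Y (act (md i (-1)) vac) k =1 act (md i (- k - 1)).
Proof.
have [Y [[YV YS] Yu]] : exists! Y : V -> distr V, is_vertex_algebra vac T Y /\
    forall a, (exists i, a = mode_field i) -> Y (a 0 vac) = a.
  apply: reconstruction => // [_ [i ->]|_ _ [i ->] [j ->]|P Pv PD Pc].
  - exact: mode_field_state.
  - exact: mode_field_local.
  apply: creation_span => // i k x Px.
  by apply: (Pc (mode_field i)) => //; exists i.
exists Y; split; first split=> // i k x.
  by have -> : act (md i (-1)) vac = mode_field i 0 vac by []; rewrite YS //; exists i.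
move=> Y' [YV' YS']; apply: Yu; split=> // _ [i ->].
apply: eq_fun2 => k x; have -> : mode_field i 0 vac = act (md i (-1)) vac by [].
by rewrite YS'.
Qed.
End Translation.
End ModeAlgebra.

(** * The modes of the affine Lie algebra *)

Section MonoidAlgebraDerivation.
Variables (A : comPzRingType) (M : choiceType) (e : M) (op : Monoid.com_law e).
Variables (wt : M -> A) (s : M -> M).
Hypothesis wtD : forall m n, wt (op m n) = wt m + wt n.
Hypothesis wt_op : forall m n, mono op (wt m) (op (s m) n) = mono op (wt m) (s (op m n)).

(** This covers -d/dt on A[t] and on A[t, 1/t] together. The hypothesis [wt_op] carries the weight
    because on natural exponents the shift is [predn], which is not compatible with addition at 0,
    where the weight vanishes. *)
Definition comonalg_der (f : comonalg A op) : comonalg A op :=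
  flift (fun m => mono op (wt m) (s m)) f.

Lemma comonalg_der_mono a m : comonalg_der (mono op a m) = mono op (a * wt m) (s m).
Proof. by rewrite /comonalg_der [LHS]linearZ /= flift_fbasis /mono scalerA. Qed.

Lemma comonalg_derB : zmod_morphism comonalg_der.
Proof. exact: raddfB. Qed.

Let wt_opM a m n :
  mono op (a * wt m) (op (s m) n) = mono op (a * wt m) (s (op m n)).
Proof. by rewrite /mono -!scalerA; congr (_ *: _); apply: wt_op. Qed.

Lemma comonalg_derM f h :
  comonalg_der (f * h) = comonalg_der f * h + f * comonalg_der h.
Proof.
have dD := zmod_morphismD comonalg_derB; have d0 := zmod_morphism0 comonalg_derB.
elim/comonalg_ind: f => [|a m f IH]; first by rewrite mul0r d0 !mul0r addr0.
rewrite mulrDl !dD !mulrDl {}IH [RHS]addrACA; congr (_ + _).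
elim/comonalg_ind: h => [|b n h IH]; first by rewrite mulr0 d0 !mulr0 addr0.
rewrite mulrDr !dD !mulrDr {}IH [RHS]addrACA; congr (_ + _).
rewrite monoM !comonalg_der_mono !monoM wtD mulrDr monoD; congr (_ + _).
  by rewrite [a * wt m * b]mulrAC wt_opM.
by rewrite [op m (s n)]Monoid.mulmC [op m n]Monoid.mulmC mulrA wt_opM.
Qed.

Lemma comonalg_der_const a : comonalg_der (mono op a e) = 0.
Proof.
have /eqP := wtD e e; rewrite Monoid.mulm1 -subr_eq subrr => /eqP wte.
by rewrite comonalg_der_mono -wte mulr0 /mono scale0r.
Qed.
End MonoidAlgebraDerivation.

(** * The derivation -d/dt and the differentials of Laurent polynomials *)

Section LaurentModes.
Variables (K : numFieldType) (g : lieAlgType K) (B : invariant_form g).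
Variables (A : comPzRingType) (eta : {rmorphism K -> A}).
Local Notation la := (lalg eta).
Local Notation pa := (palg eta).
Local Notation t := (lmono 1 1 : laurent A).
Local Notation LK := (restr la (laurent A)^o).

Let lwt (n : int) : A := (- n)%:~R.
Let pwt (n : nat) : A := (- n%:Z)%:~R.

Lemma lmonoM (a b : A) m n : lmono a m * lmono b n = lmono (a * b) (m + n).
Proof. exact: monoM. Qed.

Lemma lmonoD (a b : A) m : lmono (a + b) m = lmono a m + lmono b m.
Proof. exact: monoD. Qed.

Lemma lmonoN (a : A) m : lmono (- a) m = - lmono a m.
Proof. exact: scaleNr. Qed.

Lemma lmono1 : lmono (1 : A) 0 = 1.
Proof. exact: mono1. Qed.

Lemma lmono0 (m : int) : lmono (0 : A) m = 0.
Proof. exact: scale0r. Qed.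

Let lder_fun := comonalg_der (op := (+%R : Monoid.com_law (0 : int))) lwt (fun n => n - 1).
Let pder_fun := comonalg_der (op := (addn : Monoid.com_law 0%N)) pwt predn.

Lemma lder_derivation : exists D : derivation la,
  forall (a : A) n, D (lmono a n) = lmono (a * (- n)%:~R) (n - 1).
Proof.
have dM : forall f h, lder_fun (f * h) = lder_fun f * h + f * lder_fun h.
  apply: comonalg_derM => [m n|m n]; first by rewrite /lwt opprD intrD.
  by congr mono; rewrite /= addrAC.
have dc c : lder_fun (la c) = 0.
  by apply: comonalg_der_const => m n; rewrite /lwt opprD intrD.
exists (Derivation (comonalg_derB _ _) dM dc) => a n; exact: comonalg_der_mono.
Qed.

Lemma pder_derivation : exists D : derivation pa,
  forall (a : A) n, D (pmono a n) = pmono (a * (- n%:Z)%:~R) n.-1.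
Proof.
have dM : forall f h, pder_fun (f * h) = pder_fun f * h + f * pder_fun h.
  apply: comonalg_derM => [m n|[|m] n]; first by rewrite /pwt PoszD opprD intrD.
    by rewrite /pwt /mono !scale0r.
  by [].
have dc c : pder_fun (pa c) = 0.
  by apply: comonalg_der_const => m n; rewrite /pwt PoszD opprD intrD.
exists (Derivation (comonalg_derB _ _) dM dc) => a n; exact: comonalg_der_mono.
Qed.

Lemma laurent_ind (P : laurent A -> Prop) : P 0 ->
  (forall a n f, P f -> P (lmono a n + f)) -> forall f, P f.
Proof. exact: comonalg_ind. Qed.

Lemma polyt_incl_eta c : @polyt_incl A (pa c) = la c.
Proof. exact: polyt_inclE. Qed.

Lemma kd_tpow n : kd la (lmono 1 n) = lmono n%:~R (n - 1) *: kd la t.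
Proof.
have tS m : kd la (lmono 1 (m + 1)) = lmono 1 m *: kd la t + t *: kd la (lmono 1 m).
  by rewrite -kdM lmonoM mulr1.
have d1 : kd la (lmono 1 0) = 0.
  by have := kd_const la 1; rewrite /lalg /= rmorph1.
elim: n => [|n IH|n IH]; first by rewrite d1 lmono0 scale0r.
  have -> : n.+1%:Z = n%:Z + 1 by lia.
  have -> : (n%:Z + 1)%:~R = 1 + n%:~R :> A by rewrite intrD addrC.
  by rewrite tS IH addrK scalerA lmonoM mul1r (addrC 1) subrK lmonoD scalerDl.
(* For negative exponents the Leibniz rule for t^(m+1) = t^m t is solved for t d(t^m); the unit t is
   divided out afterwards. *)
have tdn : t *: kd la (lmono 1 (- n.+1%:Z)) = lmono (- n.+1%:Z)%:~R (- n.+1%:Z) *: kd la t.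
  have E := tS (- n.+1%:Z); move: E; have -> : - n.+1%:Z + 1 = - n%:Z by lia.
  rewrite IH => E; rewrite -[LHS](addKr (lmono 1 (- n.+1%:Z) *: kd la t)) -E.
  have -> : - n%:Z - 1 = - n.+1%:Z by lia.
  have -> : (- n.+1%:Z)%:~R = - 1 + (- n%:Z)%:~R :> A.
    by rewrite -(intrN A 1) -intrD; congr (_%:~R); lia.
  have H (x y : laurent A) (v : kaehler la) : - (x *: v) + y *: v = (- x + y) *: v.
    by rewrite scalerDl scaleNr.
  by rewrite H; congr (_ *: _); rewrite [RHS]lmonoD; congr (_ + _); rewrite [RHS]lmonoN.
have -> : kd la (lmono 1 (- n.+1%:Z)) = lmono 1 (-1) *: (t *: kd la (lmono 1 (- n.+1%:Z))).
  by rewrite scalerA lmonoM mulr1 addNr lmono1 scale1r.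
by rewrite tdn scalerA lmonoM mul1r; congr (lmono _ _ *: _); lia.
Qed.

(** Splits a differential of R into a part coming from A and a dt part. It shows that the modes span
    the centre and also computes the cocycle. *)
Lemma kd_lmono a m b n : lmono a m *: kd la (lmono b n) =
  lmono 1 (m + n) *: kaehler_map la (@lconst A) (a *: kd eta b) +
  lmono (a * b * n%:~R) (m + n - 1) *: kd la t.
Proof.
have -> : lmono b n = lconst b * lmono 1 n by rewrite lmonoM mulr1 add0r.
rewrite kdM kd_tpow kaehler_map_d // [RHS]addrC scalerDr !scalerA !lmonoM.
have -> : m + 0 + (n - 1) = m + n - 1 by lia.
have -> : m + n + 0 = m + n by lia.
by rewrite mul1r mulr1.
Qed.

(* GenDt u indexes the field of the class of u t^n dt; in the displayed field this
   is the mode with index n + 1. *)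
Inductive generator := GenJ of g & A | GenDt of A | GenOmega of kaehler eta.

Definition mode (c : generator) (n : int) : ghatR B eta :=
  match c with
  | GenJ J u => Jt B eta J u n
  | GenDt u => ftdt B eta u n
  | GenOmega w => tomega B n w
  end.

Lemma restr_lmono c a n :
  c *: (lmono a n : LK) = lmono (eta c * a) n :> laurent A.
Proof. by rewrite -[in RHS](add0r n) -lmonoM. Qed.

Lemma tens_linear (J : g) : linear (tens J : LK -> _).
Proof. by move=> c r s; apply: tens_linr. Qed.

Lemma tensZr (J : g) c (r : LK) : tens J (c *: r) = c *: tens J r.
Proof. exact: linear_scale (tens_linear J). Qed.

Lemma tens0r (J : g) : tens J (0 : LK) = 0.
Proof. exact: zmod_morphism0 (linear_zmod (tens_linear J)). Qed.

Lemma kcls_lmonoZ c a n (w : kaehler la) :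
  c *: kcls (lmono a n *: w) = kcls (lmono (eta c * a) n *: w).
Proof. by rewrite -kclsZ scalerA lmonoM add0r. Qed.

Section ModeDerivation.
Variable D : derivation la.
Hypothesis D_lmono : forall (a : A) n, D (lmono a n) = lmono (a * (- n)%:~R) (n - 1).

Lemma lie_der_const (w : kaehler eta) : lie_der D (kaehler_map la (@lconst A) w) = 0.
Proof.
have mD := @kaehler_mapD _ _ _ eta la (@lconst A) (fun _ => erefl).
have Dc a : D (lconst a) = 0 by rewrite D_lmono oppr0 mulr0 lmono0.
have lB := lie_derB D.
have m0 : kaehler_map (eta := eta) la (@lconst A) 0 = 0.
  by apply: (addIr (kaehler_map (eta := eta) la (@lconst A) 0)); rewrite -mD !add0r.
have kd0 : kd la 0 = 0 by rewrite -(rmorph0 la) kd_const.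
elim/kaehler_ind: w => [|f h w IH]; first by rewrite m0 (zmod_morphism0 lB).
rewrite mD (zmod_morphismD lB); apply: etrans (congr1 _ IH) _; rewrite addr0.
have z (x : laurent A) (v : kaehler la) : x *: 0 + 0 *: v = 0.
  by rewrite scaler0 scale0r addr0.
by rewrite kaehler_map_d; [rewrite lie_derZ lie_der_d !Dc kd0; apply: z |].
Qed.

Lemma ghat_der_mode c n : ghat_der (B := B) D (mode c n) = - n%:~R *: mode c (n - 1).
Proof.
have cD0 : cur_der (g := g) D 0 = 0.
  by apply: zmod_morphism0 (linear_zmod (cur_der_linear _)).
have kD0 : kaehlerH_der D 0 = 0.
  by apply: zmod_morphism0 (linear_zmod (kaehlerH_der_linear _)).
have En (u : A) : u * (- n)%:~R = eta (- n%:~R) * u.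
  by rewrite -mulrNz rmorph_int mulrC.
case: c => [J u|u|w]; congr pair; rewrite /= ?cD0 ?kD0 ?scaler0 //.
- by rewrite cur_der_tens D_lmono En -tensZr restr_lmono.
- rewrite kaehlerH_der_cls lie_derZ lie_der_d !D_lmono kcls_lmonoZ -En.
  (* D t = -1 is constant, so the Lie derivative kills dt and only the coefficient is
     differentiated. *)
  have -> : lmono (1 * (-1)%:~R) (1 - 1) = la (-1) by rewrite mul1r -(rmorph_int eta).
  by rewrite kd_const scaler0 add0r.
- by rewrite kaehlerH_der_cls lie_derZ lie_der_const D_lmono kcls_lmonoZ -En scaler0 add0r.
Qed.
End ModeDerivation.

(** Additivity in every entry reduces to monomials, where [kd_lmono] leaves one mode from
    differentials of A and one dt mode. *)
Lemma ghat_span (P : ghatR B eta -> Prop) :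
  (forall c x y, P x -> P y -> P (c *: x + y)) ->
  (forall c n, P (mode c n)) -> forall x, P x.
Proof.
move=> PD Pm; have PA x y : P x -> P y -> P (x + y).
  by move=> Px Py; rewrite -[x]scale1r; apply: PD.
have PJ J u n : P (tens J (lmono u n : LK), 0) by exact: (Pm (GenJ J u)).
have P0 : P (0, 0) by have := PJ 0 0 0; rewrite tens0l.
have P1 x : P (x, 0).
  elim/tensor_ind: x => [|J r x IH]; first exact: P0.
  have -> : (tens J r + x, 0) = (tens J r, 0) + (x, 0) :> ghatR B eta.
    by congr pair; rewrite addr0.
  apply: (PA _ _ _ IH); elim/laurent_ind: r => [|u n f IHf].
    by rewrite tens0r; exact: P0.
  have -> : (tens J (lmono u n + f : LK), 0) =
      (tens J (lmono u n : LK), 0) + (tens J (f : LK), 0) :> ghatR B eta.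
    by congr pair; rewrite ?addr0 //; apply: tensD.
  by apply: (PA _ _ _ IHf); apply: PJ.
have P2A w w' : P (0, kcls w) -> P (0, kcls w') -> P (0, kcls (w + w')).
  have -> : (0, kcls (w + w')) = (0, kcls w) + (0, kcls w') :> ghatR B eta.
    by congr pair; rewrite ?addr0 // kclsD.
  exact: (PA _ _).
have kcls0 : kcls (0 : kaehler la) = 0 by rewrite -(kcls_exact la 1) -(rmorph1 la) kd_const.
have P2 w : P (0, kcls w).
  elim/kaehler_ind: w => [|f h w IH]; first by rewrite kcls0; exact: P0.
  apply: (P2A _ _ _ IH); elim/laurent_ind: f => [|a m f IHf].
    by rewrite scale0r kcls0; exact: P0.
  rewrite scalerDl; apply: (P2A _ _ _ IHf) => {IHf}; elim/laurent_ind: h => [|b n h IHh].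
    by rewrite -(rmorph0 la) kd_const scaler0 kcls0; exact: P0.
  rewrite kdD scalerDr; apply: (P2A _ _ _ IHh); rewrite kd_lmono; apply: (P2A _ _).
    exact: (Pm (GenOmega _)).
  exact: (Pm (GenDt _)).
case=> x y; elim/mquot_ind: y => w.
have -> : (x, kcls w) = (x, 0) + (0, kcls w) :> ghatR B eta.
  by congr pair; rewrite ?addr0 ?add0r.
by apply: (PA _ _); [apply: P1 | apply: P2].
Qed.
End LaurentModes.

(** Serves for the factorisation of A -> R through A[t]. *)
Lemma kaehler_map_comp (K S S' S'' : comPzRingType) (eta : {rmorphism K -> S})
    (eta' : {rmorphism K -> S'}) (eta'' : {rmorphism K -> S''})
    (phi : {rmorphism S -> S'}) (psi : {rmorphism S' -> S''})
    (chi : {rmorphism S -> S''}) :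
  (forall c, phi (eta c) = eta' c) -> (forall c, psi (eta' c) = eta'' c) ->
  (forall f, chi f = psi (phi f)) ->
  forall w, kaehler_map (eta := eta) eta'' chi w =
    kaehler_map eta'' psi (kaehler_map eta' phi w).
Proof.
move=> phiE psiE chiE; have chi_eta c : chi (eta c) = eta'' c by rewrite chiE phiE psiE.
have m0 (T T' : comPzRingType) (z : {rmorphism K -> T}) (z' : {rmorphism K -> T'})
    (f : {rmorphism T -> T'}) : (forall c, f (z c) = z' c) ->
    kaehler_map (eta := z) z' f 0 = 0.
  move=> fz; apply: (addIr (kaehler_map (eta := z) z' f 0)).
  by rewrite -(kaehler_mapD fz) !add0r.
elim/kaehler_ind=> [|f h w IH]; first by rewrite !m0.
rewrite (kaehler_mapD chi_eta) (kaehler_mapD phiE) (kaehler_mapD psiE) IH.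
by rewrite !kaehler_map_d // !chiE.
Qed.

(** * The translation operator and the mode relations on the induced module *)

Section LaurentVertex.
Variables (K : numFieldType) (g : lieAlgType K) (B : invariant_form g).
Variables (A : comPzRingType) (eta : {rmorphism K -> A}).
Local Notation la := (lalg eta).
Local Notation pa := (palg eta).
Local Notation generator := (generator g eta).

(** For n >= 0 the same expression can be formed over A[t], and elements of the subalgebra kill the
    vacuum. *)
Lemma mode_vac (c : generator) (n : nat) : aff_act (mode B c n%:Z) (affvac B eta) = 0.
Proof.
have incl_vac y : aff_act (ghat_incl y) (affvac B eta) = 0.
  exact: ind_act_vac (@ghat_incl_linear _ _ _ _ _) (@ghat_incl_lie _ _ _ _ _).
suff [y ->] : exists y : ghatRplus B eta, mode B c n%:Z = ghat_incl y by apply: incl_vac.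
have iE := polyt_incl_eta eta.
have pE (v : A) k :
    (@polyt_incl A : {rmorphism _ -> _}) (pmono v k) = lmono v k%:Z by exact: polyt_inclE.
have cm0 : cur_map la (@polyt_incl A) (0 : tensor g (restr pa (polyt A)^o)) = 0.
  exact: (zmod_morphism0 (linear_zmod (cur_map_linear (g := g) iE))).
have hm0 : kaehlerH_map la (@polyt_incl A) (0 : kaehlerH pa) = 0.
  exact: zmod_morphism0 (linear_zmod (kaehlerH_map_linear iE)).
case: c => [J u|u|w].
- exists (tens J (pmono u n : restr pa (polyt A)^o), 0); congr pair; last by rewrite hm0.
  by rewrite [RHS](cur_map_tens iE) pE.
- exists (0, kcls (pmono u n *: kd pa (pmono 1 1))); congr pair; first by rewrite cm0.
  by rewrite [RHS](kaehlerH_map_cls iE) (kaehler_map_d iE) !pE.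
exists (0, kcls (pmono 1 n *: kaehler_map pa (@pconst A) w)); congr pair.
  by rewrite cm0.
rewrite [RHS](kaehlerH_map_cls iE) (kaehler_mapZ iE) pE; congr (kcls (_ *: _)).
apply: kaehler_map_comp => // f; exact/esym/pE.
Qed.

Lemma mode_lie (a b : generator) : exists c1 c2 c3 : generator, exists e : K, forall m n,
  lie (mode B a m) (mode B b n) =
  mode B c1 (m + n) + (e *: mode B c2 (m + n) + (e * n%:~R) *: mode B c3 (m + n - 1)).
Proof.
have central x y (w w' : kaehlerH la) : x = 0 \/ y = 0 ->
    lie ((x, w) : ghatR B eta) ((y, w') : ghatR B eta) = 0.
  case=> ->; congr pair.
  - exact: zmod_morphism0 (linear_zmod (cur_lie_linearl _)).
  - exact: zmod_morphism0 (linear_zmod (cocycle_linearl _ _)).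
  - exact: zmod_morphism0 (linear_zmod (cur_lie_linearr _)).
  - exact: zmod_morphism0 (linear_zmod (cocycle_linearr _ _)).
(* When one factor is central, the required shape is filled with the zero modes of
   [GenJ eta 0 0]. *)
have trivial m n (x : ghatR B eta) : x = 0 ->
    x = mode B (GenJ eta 0 0) (m + n) + (0 *: mode B (GenJ eta 0 0) (m + n) +
      (0 * n%:~R) *: mode B (GenJ eta 0 0) (m + n - 1)).
  have m0 k : mode B (GenJ eta 0 0) k = 0 by congr pair; apply: tens0l.
  by move=> ->; rewrite !m0 !scaler0 !addr0.
case: a => [J u|u|w]; last 2 first.
- exists (GenJ eta 0 0), (GenJ eta 0 0), (GenJ eta 0 0), 0 => m n.
  by apply: trivial; case: b => [J v|v|w']; apply: central; left.
- exists (GenJ eta 0 0), (GenJ eta 0 0), (GenJ eta 0 0), 0 => m n.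
  by apply: trivial; case: b => [J v|v|w']; apply: central; left.
case: b => [J' v|v|w]; last 2 first.
- exists (GenJ eta 0 0), (GenJ eta 0 0), (GenJ eta 0 0), 0 => m n.
  by apply: trivial; apply: central; right.
- exists (GenJ eta 0 0), (GenJ eta 0 0), (GenJ eta 0 0), 0 => m n.
  by apply: trivial; apply: central; right.
(* The central term is a multiple of u t^m d(v t^n), which [kd_lmono] splits into t^(m+n) u dv and n
   u v t^(m+n-1) dt. *)
exists (GenJ eta (lie J J') (u * v)), (GenOmega g (u *: kd eta v)), (GenDt g eta (u * v)),
  (B J J').
move=> m n; congr pair.
  by rewrite /= !scaler0 !addr0 [LHS]cur_lieE lmonoM.
rewrite /= add0r [LHS]cocycleE (kd_lmono eta u m v n) kclsD scalerDr -scalerA.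
by rewrite [X in _ = _ + _ *: X]kcls_lmonoZ rmorph_int [n%:~R * _]mulrC.
Qed.

Lemma translation_exists : exists T, is_translation (B := B) (eta := eta) T.
Proof.
have [D D_lmono] := lder_derivation eta; have [D' D'_pmono] := pder_derivation eta.
have iD f : @polyt_incl A (D' f) = D (@polyt_incl A f).
  have iB := zmod_morphismD (@polyt_incl_zmod A).
  elim/comonalg_ind: f => [|a n f IH].
    rewrite (zmod_morphism0 (derB D')) (zmod_morphism0 (@polyt_incl_zmod A)).
    by rewrite (zmod_morphism0 (derB D)).
  rewrite derD !iB derD IH; congr (_ + _).
  rewrite [X in polyt_incl X]D'_pmono !polyt_inclE D_lmono.
  (* At exponent 0 the shifts on A[t] and on R disagree, but the coefficient is zero. *)
  case: n => [|n]; first by rewrite oppr0 mulr0 !lmono0.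
  by congr lmono; lia.
have [T [Tl Tv Tact]] := ind_der_exists (@ghat_incl_linear _ _ B _ eta)
  (@ghat_incl_lie _ _ B _ eta) (@ghat_der_linear _ _ B _ _ D) (@ghat_der_lie _ _ B _ _ D)
  (@ghat_der_linear _ _ B _ _ D') (@ghat_der_lie _ _ B _ _ D')
  (ghat_map_der (polyt_incl_eta eta) iD).
have Tm (c : generator) n x : opcomm T (aff_act (mode B c n)) x =
    - n%:~R *: aff_act (mode B c (n - 1)) x.
  rewrite [LHS]Tact (ghat_der_mode B D_lmono).
  exact: (linear_scale _ _ (ind_act_linearl x)).
exists T; split=> // [J f n x|f n x|w n x].
- exact: (Tm (GenJ eta J f)).
- exact: (Tm (GenDt g eta f)).
- exact: (Tm (GenOmega g w)).
Qed.

Lemma translation_mode T : is_translation (B := B) (eta := eta) T ->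
  forall (c : generator) n x, opcomm T (aff_act (mode B c n)) x =
    - n%:~R *: aff_act (mode B c (n - 1)) x.
Proof. by move=> [_ _ TJ Tt Tw] [J u|u|w] n x; [apply: TJ | apply: Tt | apply: Tw]. Qed.

Lemma translation_exists_unique : exists! T, is_translation (B := B) (eta := eta) T.
Proof.
have [T Tt] := translation_exists; exists T; split=> // T' Tt'.
apply: (@translation_unique K (ghatR B eta) (affV B eta) (affvac B eta)
  (@aff_act _ _ B _ eta) _ (@mode _ _ B _ eta) (@ind_act_linearl _ _ _ _)
  (@ghat_span _ _ B _ eta) (@induced_ind _ _ _ _) T T' (translation_linear Tt) (translation_linear Tt')).
  by rewrite (translation_vac Tt) (translation_vac Tt').
move=> c n; exists (- n%:~R *: mode B c (n - 1)) => v.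
have -> : aff_act (- n%:~R *: mode B c (n - 1)) v =
    - n%:~R *: aff_act (mode B c (n - 1)) v.
  exact: linear_scale (ind_act_linearl v).
by split; apply: translation_mode.
Qed.
End LaurentVertex.

Theorem theorem2p8 (R : realType) (g : lieAlgType R[i]) (B : invariant_form g)
    (A : comPzRingType) (eta : {rmorphism R[i] -> A}) :
  (exists! T, is_translation (B := B) (eta := eta) T) /\
  forall T : affV B eta -> affV B eta, is_translation T ->
    exists! Y : affV B eta -> distr (affV B eta),
      is_vertex_algebra (affvac B eta) T Y /\
      [/\ forall (J : g) (u : A) (n : int),
           Y (aff_act (Jt B eta J u (-1)) (affvac B eta)) (- n - 1) =1
           aff_act (Jt B eta J u n),
         forall (u : A) (n : int),
           Y (aff_act (ftdt B eta u (-1)) (affvac B eta)) (- n) =1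
           aff_act (ftdt B eta u (n - 1))
       & forall (w : kaehler eta) (n : int),
           Y (aff_act (tomega B (-1) w) (affvac B eta)) (- n - 1) =1
           aff_act (tomega B n w)].
Proof.
split=> [|T Tt]; first exact: translation_exists_unique.
have [Y [[YV Ym] Yu]] := mode_vertex_algebra
  (act := @aff_act _ _ B _ eta) (md := @mode _ _ B _ eta)
  (@ind_act_linearl _ _ _ _) (@ind_act_linear _ _ _ _) (@ind_act_lie _ _ _ _)
  (@ghat_span _ _ B _ eta) (@induced_ind _ _ _ _) (@mode_vac _ _ B _ eta)
  (@mode_lie _ _ B _ eta) (translation_linear Tt) (translation_vac Tt)
  (translation_mode Tt).
(* The passage between the index of a mode and its exponent of z is an involution, used here in both
   directions. *)
have E (n : int) : - (- n - 1) - 1 = n by lia.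
exists Y; split; first split; first exact: YV.
  split=> [J u n|u n|w n].
  - by have := Ym (GenJ eta J u) (- n - 1); rewrite E.
  - by have := Ym (GenDt g eta u) (- n); rewrite opprK.
  - by have := Ym (GenOmega g w) (- n - 1); rewrite E.
move=> Y' [YV' [YJ Yt Yw]]; apply: Yu; split; first exact: YV'.
case=> [J u|u|w] k.
- by have := YJ J u (- k - 1); rewrite E.
- by have := Yt u (- k); rewrite opprK.
- by have := Yw w (- k - 1); rewrite E.
Qed.
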